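(* Let $\Phi:G\times S_{\mathrm{reg}}\to\mathfrak{g}$ be the map $\Phi(g,x)=-\mathrm{Ad}_{g^{-1}}(x)$. If $x\in\mathfrak{g}_{\mathrm{reg}}$, then $\Phi^{-1}(x)$ is an isotropic subvariety of $G\times S_{\mathrm{reg}}$.
   Context: $G$ is a connected, simply-connected, complex semisimple linear algebraic group of rank $\mathrm{rk}(G)$, with Lie algebra $\mathfrak{g}$, Killing form $\langle\cdot,\cdot\rangle$, and adjoint representation $\mathrm{Ad}$. For $x\in\mathfrak{g}$, $Z_{\mathfrak{g}}(x)=\{y\in\mathfrak{g}:[x,y]=0\}$; $\mathfrak{g}_{\mathrm{reg}}=\{x\in\mathfrak{g}:\dim Z_{\mathfrak{g}}(x)=\mathrm{rk}(G)\}$ is the set of regular elements (not assumed semisimple). There is exactly one nilpotent adjoint orbit consisting of regular elements, denoted $\mathcal{O}_{\mathrm{reg}}$. Fix a regular $\mathfrak{sl}_2(\mathbb{C})$-triple $(\xi,h,\eta)$ in $\mathfrak{g}$, i.e. $[\xi,\eta]=h$, $[h,\xi]=2\xi$, $[h,\eta]=-2\eta$ with $\xi,\eta\in\mathcal{O}_{\mathrm{reg}}$. The associated Slodowy slice is $S_{\mathrm{reg}}:=\xi+Z_{\mathfrak{g}}(\eta)\subseteq\mathfrak{g}$. $G\times\mathfrak{g}$ carries the holomorphic symplectic form $$\omega_{(g,x)}\big((d_eR_g(y_1),z_1),(d_eR_g(y_2),z_2)\big)=\langle y_1,z_2\rangle-\langle y_2,z_1\rangle-\langle x,[y_1,y_2]\rangle,\quad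 y_1,y_2,z_1,z_2\in\mathfrak{g},$$ where $R_g$ is right multiplication by $g$. The holomorphic symplectic form on $G\times S_{\mathrm{reg}}$ is the restriction of $\omega$ (known, by Bielawski, to be symplectic). A smooth subvariety is isotropic if the symplectic form vanishes on each of its tangent spaces. *)

(* Defs.v *)
From HB Require Import structures.
From mathcomp Require Import all_boot all_order all_algebra complex.
From mathcomp Require Import boolp classical_sets set_interval reals topology normedtype.
(* The notations of mpoly clash with those of the analysis library. *)
From mathcomp Require Import -(notations) mpoly.

Set Implicit Arguments.
Unset Strict Implicit.
Unset Printing Implicit Defensive.

Import GRing.Theory Num.Theory.
Import numFieldNormedType.Exports.

Local Open Scope classical_set_scope.
Local Open Scope ring_scope.

(* As a numClosedFieldType, R[i] carries the topology given by its modulus. *)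
Definition C (R : realType) : numClosedFieldType := R[i].

(* Polynomial functions on V are written in the coordinates of the basis
   vbasis {:V}; no notion below depends on which basis is used. *)
Definition crd (K : fieldType) (V : vectType K) (p : V) :
  'I_(\dim {:V}) -> K := fun i => coord (vbasis {:V}) i p.

Notation polyfun V := (mpoly.mpoly (\dim (fullv : {vspace V})) _).

Definition peval (K : fieldType) (V : vectType K) (f : polyfun V) (p : V) : K :=
  mpoly.meval (crd p) f.

Definition ppartial (K : fieldType) (V : vectType K) (i : 'I_(\dim {:V}))
  (f : polyfun V) (p : V) : K := mpoly.meval (crd p) (mpoly.mderiv i f).

Definition pdiff (K : fieldType) (V : vectType K) (f : polyfun V) (p v : V) : K :=
  \sum_i crd v i * ppartial i f p.

Definition vanishing_ideal (K : fieldType) (V : vectType K) (X : set V) :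
  set (polyfun V) := [set f | forall p, X p -> peval f p = 0].

(* X is a subset of Y, closed for the Zariski topology of Y. *)
Definition zariski_closed_in (K : fieldType) (V : vectType K) (Y X : set V) :=
  exists F : set (polyfun V),
    X = Y `&` [set p | forall f, F f -> peval f p = 0].

Definition zariski_connected (K : fieldType) (V : vectType K) (X : set V) :=
  forall A, zariski_closed_in X A -> zariski_closed_in X (X `\` A) ->
    A = set0 \/ A = X.

(* The ideal of X is also that of its closure, so this is the Zariski tangent
   space as soon as X is locally closed; the same holds of smooth_at. *)
Definition tangent_space (K : fieldType) (V : vectType K) (X : set V) (p : V) :
  set V := [set v | forall f, vanishing_ideal X f -> pdiff f p v = 0].

(* Smoothness over the base field: on a Zariski neighbourhood s <> 0 of p, the
   ideal of X is generated by functions f_1, ..., f_r whose differentials at p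
   are linearly independent. *)
Definition smooth_at (K : fieldType) (V : vectType K) (X : set V) (p : V) :=
  exists (r : nat) (f : 'I_r -> polyfun V) (s : polyfun V),
    [/\ forall i, vanishing_ideal X (f i),
        peval s p <> 0,
        forall q, vanishing_ideal X q ->
          exists a : 'I_r -> polyfun V, s * q = \sum_i a i * f i
      & row_free (\matrix_(i, j) ppartial j (f i) p)].

Definition smooth (K : fieldType) (V : vectType K) (X : set V) :=
  forall p, X p -> smooth_at X p.

(* The linear subspace whose set of elements is A; meaningful only when A is
   closed under linear combinations, see subspace_ofP. *)
Definition subspace_of (K : fieldType) (V : vectType K) (A : set V) : {vspace V} :=
  xget 0%VS [set U : {vspace V} | forall v, v \in U <-> A v].

Lemma subspace_ofP (K : fieldType) (V : vectType K) (A : set V) :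
  A 0 -> (forall a u v, A u -> A v -> A (a *: u + v)) ->
  forall v, v \in subspace_of A <-> A v.
Proof.
move=> A0 Alin.
suff [U UA] : exists U : {vspace V}, forall v, v \in U <-> A v.
  by rewrite /subspace_of; case: xgetP => [W _ //|/(_ U)]; case.
pose P d := `[< exists U : {vspace V}, (forall v, v \in U -> A v) /\ \dim U = d >].
have exP : exists d, P d.
  exists 0%N; apply/asboolP; exists 0%VS; split; last by rewrite dimv0.
  by move=> v; rewrite memv0 => /eqP ->.
have ubP d : P d -> (d <= \dim {:V})%N.
  by move=> /asboolP[U [_ <-]]; rewrite dimvS ?subvf.
have [d /asboolP[U [UA dU]] maxd] := ex_maxnP exP ubP.
exists U => v; split=> [/UA//|Av].
apply/negPn/negP => vU.
have /maxd : P (\dim (<[v]> + U)%VS).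
  apply/asboolP; exists (<[v]> + U)%VS; split=> // w.
  move=> /memv_addP[x /vlineP[k ->] [y /UA Ay ->]]; exact: Alin.
rewrite leqNgt -dU => /negP; apply.
rewrite (ltn_leqif (dimv_leqif_sup (addvSr _ _))).
by apply: contra vU; apply: subv_trans (addvSl _ _).
Qed.

Definition GL (K : fieldType) (n : nat) : set 'M[K]_n := [set g | g \in unitmx].
Arguments GL K n : clear implicits.

Definition subgroup (K : fieldType) (n : nat) (H : set 'M[K]_n) :=
  [/\ H `<=` GL K n, H 1%:M, forall a b, H a -> H b -> H (a *m b)
    & forall a, H a -> H (invmx a)].

Definition algebraic_group (K : fieldType) (n : nat) (H : set 'M[K]_n) :=
  subgroup H /\ zariski_closed_in (GL K n) H.

Definition normal_in (K : fieldType) (n : nat) (G N : set 'M[K]_n) :=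
  N `<=` G /\ forall g a, G g -> N a -> N (g *m a *m invmx g).

Definition derived (K : fieldType) (n : nat) (H : set 'M[K]_n) : set 'M[K]_n :=
  [set c | forall L, subgroup L ->
     (forall a b, H a -> H b -> L (a *m b *m invmx a *m invmx b)) -> L c].

Definition solvable_group (K : fieldType) (n : nat) (H : set 'M[K]_n) :=
  exists k, iter k (@derived K n) H `<=` [set 1%:M].

(* The radical of G, its largest closed connected solvable normal subgroup, is
   trivial. *)
Definition semisimple (K : fieldType) (n : nat) (G : set 'M[K]_n) :=
  forall N, algebraic_group N -> normal_in G N -> zariski_connected N ->
    solvable_group N -> N = [set 1%:M].

(* The regular functions on a closed subgroup of GL_n are the f / \det ^ k. *)
Definition regular_map (K : fieldType) (n m : nat) (A : set 'M[K]_n)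
    (phi : 'M[K]_n -> 'M[K]_m) :=
  forall i j, exists (f : polyfun 'M[K]_n) (k : nat),
    forall g, A g -> phi g i j = peval f g / \det g ^+ k.

Definition algebraic_isomorphic (K : fieldType) (n m : nat)
    (A : set 'M[K]_n) (B : set 'M[K]_m) :=
  exists (phi : 'M[K]_n -> 'M[K]_m) (psi : 'M[K]_m -> 'M[K]_n),
    [/\ regular_map A phi /\ regular_map B psi,
        forall g, A g -> B (phi g) /\ psi (phi g) = g,
        forall g, B g -> A (psi g) /\ phi (psi g) = g
      & forall a b, A a -> A b -> phi (a *m b) = phi a *m phi b].

Definition diagonal_group (K : fieldType) (r : nat) : set 'M[K]_r :=
  [set d | GL K r d /\ is_diag_mx d].
Arguments diagonal_group K r : clear implicits.

Definition torus (K : fieldType) (n r : nat) (T : set 'M[K]_n) :=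
  algebraic_group T /\ algebraic_isomorphic T (diagonal_group K r).

(* The dimension of a maximal torus.  Bounding r by n loses nothing, since a
   torus of GL_n has dimension at most n. *)
Definition rk (K : fieldType) (n : nat) (G : set 'M[K]_n) : nat :=
  \max_(r < n.+1 | `[< exists T : set 'M[K]_n, torus r T /\ T `<=` G >]) r.

(* Every loop in G, for the Euclidean topology, is homotopic to a constant one
   relatively to its end points.  Connectedness is not included. *)
Definition simply_connected (R : realType) (n : nat) (G : set 'M[C R]_n) :=
  forall gamma : R -> 'M[C R]_n,
    {within `[0, 1]%classic, continuous gamma} ->
    gamma @` `[0, 1]%classic `<=` G -> gamma 0 = gamma 1 ->
  exists H : R * R -> 'M[C R]_n,
    [/\ {within `[0, 1]%classic `*` `[0, 1]%classic, continuous H},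
        H @` (`[0, 1]%classic `*` `[0, 1]%classic) `<=` G,
        forall t, t \in `[0, 1] -> H (0, t) = gamma t /\ H (1, t) = gamma 0
      & forall s, s \in `[0, 1] -> H (s, 0) = gamma 0 /\ H (s, 1) = gamma 0].

Definition lie (K : fieldType) (n : nat) (a b : 'M[K]_n) : 'M[K]_n :=
  a *m b - b *m a.

Fact lie_is_linear (K : fieldType) (n : nat) (a : 'M[K]_n) : linear (lie a).
Proof.
move=> k u v; rewrite /lie mulmxDr mulmxDl -scalemxAr -scalemxAl.
by rewrite opprD addrACA scalerBr.
Qed.

HB.instance Definition _ (K : fieldType) (n : nat) (a : 'M[K]_n) :=
  GRing.isLinear.Build K 'M[K]_n 'M[K]_n _ (lie a) (lie_is_linear a).

Definition lie_alg (K : fieldType) (n : nat) (G : set 'M[K]_n) : {vspace 'M[K]_n} :=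
  subspace_of (tangent_space G 1%:M).

Lemma mem_lie_alg (K : fieldType) (n : nat) (G : set 'M[K]_n) (y : 'M[K]_n) :
  y \in lie_alg G <-> tangent_space G 1%:M y.
Proof.
apply: subspace_ofP => [f _|k u v Tu Tv f If].
  by rewrite /pdiff big1 // => i _; rewrite /crd linear0 mul0r.
transitivity (k * pdiff f 1%:M u + pdiff f 1%:M v); last first.
  by rewrite Tu // Tv // mulr0 addr0.
rewrite /pdiff mulr_sumr -big_split; apply: eq_bigr => i _ /=.
by rewrite /crd linearP /= mulrDl mulrA.
Qed.

Definition Ad (K : fieldType) (n : nat) (g y : 'M[K]_n) : 'M[K]_n :=
  g *m y *m invmx g.

(* The trace over L of ad a \o ad b, for a and b in the Lie subalgebra L. *)
Definition killing (K : fieldType) (n : nat) (L : {vspace 'M[K]_n})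
    (a b : 'M[K]_n) : K :=
  \sum_(i < \dim L) coord (vbasis L) i (lie a (lie b (vbasis L)`_i)).

Definition centralizer (K : fieldType) (n : nat) (L : {vspace 'M[K]_n})
  (x : 'M[K]_n) : {vspace 'M[K]_n} := (L :&: lker (linfun (lie x)))%VS.

Lemma mem_centralizer (K : fieldType) (n : nat) (L : {vspace 'M[K]_n})
    (x y : 'M[K]_n) :
  (y \in centralizer L x) = (y \in L) && (lie x y == 0).
Proof. by rewrite memv_cap memv_ker lfunE. Qed.

Definition regular_elements (K : fieldType) (n : nat) (G : set 'M[K]_n) :
    set 'M[K]_n :=
  [set x | x \in lie_alg G /\ \dim (centralizer (lie_alg G) x) = rk G].

Definition nilpotent_element (K : fieldType) (n : nat) (L : {vspace 'M[K]_n})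
    (x : 'M[K]_n) :=
  x \in L /\ exists k, forall y, y \in L -> iter k (lie x) y = 0.

Definition adjoint_orbit (K : fieldType) (n : nat) (G : set 'M[K]_n)
  (x : 'M[K]_n) : set 'M[K]_n := [set Ad g x | g in G].

(* The union of the nilpotent adjoint orbits consisting of regular elements, of
   which there is exactly one when G is connected and semisimple. *)
Definition regular_nilpotent_orbit (K : fieldType) (n : nat) (G : set 'M[K]_n) :
    set 'M[K]_n :=
  [set y | exists x, [/\ nilpotent_element (lie_alg G) x,
     adjoint_orbit G x `<=` regular_elements G & adjoint_orbit G x y]].

Definition regular_sl2_triple (K : fieldType) (n : nat) (G : set 'M[K]_n)
    (xi h eta : 'M[K]_n) :=
  [/\ regular_nilpotent_orbit G xi /\ regular_nilpotent_orbit G eta,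
      h \in lie_alg G,
      lie xi eta = h,
      lie h xi = 2 *: xi
    & lie h eta = - 2 *: eta].

Definition slodowy_slice (K : fieldType) (n : nat) (G : set 'M[K]_n)
    (xi eta : 'M[K]_n) : set 'M[K]_n :=
  [set xi + z | z in [set z | z \in centralizer (lie_alg G) eta]].

(* The tangent vector (v, z) of G x g at (g, x) is (d_e R_g y, z) = (y *m g, z)
   for y = v *m invmx g. *)
Definition omega (K : fieldType) (n : nat) (G : set 'M[K]_n)
    (p : 'M[K]_n * 'M[K]_n) (v1 v2 : 'M[K]_n * 'M[K]_n) : K :=
  let kill := killing (lie_alg G) in
  let y1 := v1.1 *m invmx p.1 in
  let y2 := v2.1 *m invmx p.1 in
  kill y1 v2.2 - kill y2 v1.2 - kill p.2 (lie y1 y2).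

Definition Phi (K : fieldType) (n : nat) (p : 'M[K]_n * 'M[K]_n) : 'M[K]_n :=
  - Ad (invmx p.1) p.2.

Definition Phi_fiber (K : fieldType) (n : nat) (G S : set 'M[K]_n)
    (x : 'M[K]_n) : set ('M[K]_n * 'M[K]_n) :=
  [set p | (G `*` S) p /\ Phi p = x].

(* A subvariety need not be irreducible: the fibers of interest are translates
   of centralizers, which can be disconnected. *)
Definition isotropic_subvariety (K : fieldType) (n : nat) (G S : set 'M[K]_n)
    (X : set ('M[K]_n * 'M[K]_n)) :=
  [/\ zariski_closed_in (G `*` S) X, smooth X
    & forall p v1 v2, X p -> tangent_space X p v1 -> tangent_space X p v2 ->
        omega G p v1 v2 = 0].

(* Main.v *)
(* The fiber X is {(g, s) | s g + g x = 0}.  Let (v, z) be tangent to X at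
   (g, s) and y = v g^-1: then y lies in the Lie algebra, z in Z(eta), and
   differentiating the equation gives z = [y, s].  By sl2-theory [xi, g] and
   Z(eta) are complementary (xi and eta being regular), and since s - xi has
   nonpositive weights [s, g] + Z(eta) is still everything; as s is regular the
   sum is direct, so z = 0 and [s, y] = 0.  Hence omega reduces to
   - <s, [y1, y2]>, the trace of a commutator.

   For smoothness, the s-coordinate q has zero differential on X.  In
   characteristic 0, where the tangent dimension is locally minimal, the ideal
   of X together with q - q(p) is stable under derivations dual to local
   coordinates; by Krull's intersection theorem it is then locally generated by
   the equations with independent differentials.  So s is locally constant on a
   dense part of X, hence takes finitely many values by noetherianity and is
   locally constant on X.  Thus X is locally a coset of the centralizer of x, the
   tangent dimension is locally constant, and the same argument gives
   smoothness everywhere. *)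
From HB Require Import structures.
Require Import Defs.
From mathcomp Require Import all_boot all_order all_algebra complex.
From mathcomp Require Import boolp classical_sets reals.
From mathcomp Require Import mpoly.
From mathcomp Require Import ring zify.

Set Implicit Arguments.
Unset Strict Implicit.
Unset Printing Implicit Defensive.

Import Order.TTheory GRing.Theory Num.Theory.

Local Open Scope classical_set_scope.
Local Open Scope ring_scope.

(** * Noetherianity of polynomial rings *)

(** Each index is chosen to minimise [v] beyond the index before it. The successive minima are taken
    over smaller and smaller tails, so they do not decrease. *)
Lemma nondecreasing_subseq (v : nat -> nat) :
  exists2 phi : nat -> nat, {homo phi : a b / (a < b)%N} &
    {homo v \o phi : a b / (a <= b)%N}.
Proof.
have argmin a : exists b, (a <= b)%N /\ forall c, (a <= c)%N -> (v b <= v c)%N.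
  have exv : exists k, `[< exists2 b, (a <= b)%N & v b = k >].
    by exists (v a); apply/asboolP; exists a.
  case: (ex_minnP exv) => k /asboolP[b ab <-] kmin.
  by exists b; split=> // c ac; apply: kmin; apply/asboolP; exists c.
have [m mP] := choice argmin.
pose phi := fix phi k := if k is k'.+1 then m (phi k').+1 else m 0%N.
have phiS k : (phi k < phi k.+1)%N by have [] := mP (phi k).+1.
exists phi; first exact: (homo_ltn ltn_trans phiS).
apply: (@homo_leq _ (v \o phi) leq) => [//|b a c|k /=]; first exact: leq_trans.
case: k => [|k] /=; first by apply: (mP 0%N).2.
apply: (mP (phi k).+1).2; apply: leq_trans (phiS k) _.
by apply: ltnW; apply: leq_trans (phiS k.+1).
Qed.

(** Dickson's lemma: refining the sequence one coordinate at a time gives a subsequence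
    nondecreasing in every coordinate, whose first two terms serve. *)
Lemma dickson n (m : nat -> 'X_{1..n}) :
  exists i j, (i < j)%N /\ (m i <= m j)%MM.
Proof.
suff [phi phiS phiM] : exists2 phi : nat -> nat, {homo phi : a b / (a < b)%N} &
    forall i, i \in enum 'I_n -> {homo (fun k => m (phi k) i) : a b / (a <= b)%N}.
  exists (phi 0%N), (phi 1%N); split; first exact: phiS.
  by apply/mnm_lepP => i; apply: (phiM i _ 0%N 1%N); rewrite ?mem_enum.
elim: (enum 'I_n) => [|i s [phi phiS phiM]]; first by exists id.
have [psi psiS psiM] := nondecreasing_subseq (fun k => m (phi k) i).
exists (phi \o psi) => [a b ab|j]; first exact/phiS/psiS.
rewrite inE => /predU1P[->|js]; first exact: psiM.
move=> a b ab; apply: phiM => //.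
by move: ab; rewrite leq_eqVlt => /predU1P[->//|/psiS/ltnW].
Qed.

Section Ideals.
Variable A : comNzRingType.

Definition ideal (I : set A) :=
  [/\ I 0, forall a b, I a -> I b -> I (a + b) & forall a b, I b -> I (a * b)].

Definition generated r (f : 'I_r -> A) : set A :=
  [set q | exists a : 'I_r -> A, q = \sum_i a i * f i].

(** The ascending chain condition in sequence form: no sequence has all its terms outside the ideal
    generated by the earlier ones. *)
Definition noetherian :=
  forall u : nat -> A, exists n, generated (fun i : 'I_n => u i) (u n).

Lemma ideal_generated r (f : 'I_r -> A) : ideal (generated f).
Proof.
split=> [|_ _ [a ->] [b ->]|a _ [b ->]].
- by exists (fun=> 0); rewrite big1 // => i _; rewrite mul0r.
- exists (fun i => a i + b i); rewrite -big_split /=.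
  by apply: eq_bigr => i _; rewrite mulrDl.
- exists (fun i => a * b i); rewrite mulr_sumr.
  by apply: eq_bigr => i _; rewrite mulrA.
Qed.

Lemma mem_generated r (f : 'I_r -> A) i : generated f (f i).
Proof.
exists (fun j => (j == i)%:R); rewrite (bigD1 i) //= eqxx mul1r.
by rewrite big1 ?addr0 // => j /negPf ->; rewrite mul0r.
Qed.

Section Closure.
Variables (I : set A) (idI : ideal I).

Lemma ideal0 : I 0. Proof. by case: idI. Qed.
Lemma idealD a b : I a -> I b -> I (a + b). Proof. by case: idI => _ + _; apply. Qed.
Lemma idealMl a b : I b -> I (a * b). Proof. by case: idI => _ _; apply. Qed.
Lemma idealMr a b : I b -> I (b * a). Proof. by rewrite mulrC; apply: idealMl. Qed.
Lemma idealN a : I a -> I (- a). Proof. by rewrite -mulN1r; apply: idealMl. Qed.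
Lemma idealB a b : I a -> I b -> I (a - b).
Proof. by move=> Ia Ib; apply/idealD/idealN. Qed.

Lemma ideal_sum (T : Type) (s : seq T) (P : pred T) (F : T -> A) :
  (forall i, P i -> I (F i)) -> I (\sum_(i <- s | P i) F i).
Proof. by move=> IF; apply: big_ind => //; [apply: ideal0|apply: idealD]. Qed.

Lemma generated_sub r (f : 'I_r -> A) : (forall i, I (f i)) -> generated f `<=` I.
Proof. by move=> If _ [a ->]; apply: ideal_sum => i _; apply/idealMl. Qed.

End Closure.

Definition idealA (I J : set A) : set A :=
  [set q | exists a b, [/\ I a, J b & q = a + b]].

Lemma ideal_idealA I J : ideal I -> ideal J -> ideal (idealA I J).
Proof.
move=> idI idJ; split.
- by exists 0, 0; split; [apply: ideal0|apply: ideal0|rewrite addr0].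
- move=> _ _ [a [b [Ia Jb ->]]] [c [d [Ic Jd ->]]].
  by exists (a + c), (b + d); split; [apply: idealD|apply: idealD|rewrite addrACA].
- move=> x _ [a [b [Ia Jb ->]]].
  by exists (x * a), (x * b); split; [apply: idealMl|apply: idealMl|rewrite mulrDr].
Qed.

Lemma idealA_subl I J : ideal J -> I `<=` idealA I J.
Proof. by move=> idJ a Ia; exists a, 0; split; rewrite ?addr0 //; apply: ideal0. Qed.

Lemma idealA_subr I J : ideal I -> J `<=` idealA I J.
Proof. by move=> idI a Ia; exists 0, a; split; rewrite ?add0r //; apply: ideal0. Qed.

Definition principal (a : A) : set A := [set q | exists b, q = b * a].

Lemma ideal_principal a : ideal (principal a).
Proof.
split; first by exists 0; rewrite mul0r.
- by move=> _ _ [b ->] [c ->]; exists (b + c); rewrite mulrDl.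
- by move=> x _ [b ->]; exists (x * b); rewrite mulrA.
Qed.

Lemma mem_principal a : principal a a.
Proof. by exists 1; rewrite mul1r. Qed.

Section Noetherian.
Hypothesis noethA : noetherian.

(** Otherwise every finite list in [Q] extends by an element of [Q] outside the ideal of the list,
    and the resulting sequence contradicts noetherianity. *)
Lemma noetherian_finite (Q : set A) : ideal Q ->
  exists r (f : 'I_r -> A), (forall i, Q (f i)) /\ Q `<=` generated f.
Proof.
move=> idQ; apply: contrapT => nfin.
(* Nothing is asked of [q] when [s] is not contained in [Q]; this makes the choice total in [s]. *)
have next (s : seq A) : exists q, all (fun x => `[< Q x >]) s ->
    Q q /\ ~ generated (fun i : 'I_(size s) => s`_i) q.
  have [sQ|] := boolP (all (fun x => `[< Q x >]) s); last by exists 0.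
  apply: contrapT => nq; apply: nfin; exists (size s), (fun i => s`_i); split.
    by move=> i; apply/asboolP/(allP sQ)/mem_nth.
  by move=> q Qq; apply: contrapT => ngq; apply: nq; exists q.
have [g gP] := choice next.
pose s := fix s n := if n is n'.+1 then rcons (s n') (g (s n')) else [::].
have size_s n : size (s n) = n by elim: n => //= n IHn; rewrite size_rcons IHn.
have sQ n : all (fun x => `[< Q x >]) (s n).
  elim: n => //= n IHn; rewrite all_rcons IHn andbT.
  by apply/asboolP; case: (gP _ IHn).
pose u n := g (s n).
have su n i : (i < n)%N -> (s n)`_i = u i.
  elim: n => //= n IHn; rewrite ltnS nth_rcons size_s leq_eqVlt.
  by case: ltngtP => //= [/IHn ->//|-> _].
have [n [a]] := noethA u.
case: (gP _ (sQ n)) => _ + ua; apply; rewrite size_s.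
by exists a; rewrite -/(u n) ua; apply: eq_bigr => i _; rewrite su.
Qed.

(** Elements [u n] of [L n.+1] outside [L n] would contradict noetherianity, since all the earlier
    terms lie in [L n]. *)
Lemma noetherian_chain (L : nat -> set A) : (forall n, ideal (L n)) ->
  (forall n, L n `<=` L n.+1) -> exists n, L n.+1 `<=` L n.
Proof.
move=> idL LS; apply: contrapT => nst.
have next n : exists q, L n.+1 q /\ ~ L n q.
  apply: contrapT => nq; apply: nst; exists n => q Lq.
  by apply: contrapT => nLq; apply: nq; exists q.
have [u uP] := choice next.
have [n gn] := noethA u.
have [_] := uP n; apply; apply: (generated_sub (idL n)) gn => i.
have mono a b : (a <= b)%N -> L a `<=` L b.
  elim: b => [|b IHb]; first by rewrite leqn0 => /eqP ->.
  by rewrite leq_eqVlt => /predU1P[->//|/IHb ab]; apply: subset_trans ab (LS b).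
exact: mono (ltn_ord i) _ (uP i).1.
Qed.

Lemma noetherian_maximal (P : set (set A)) (L0 : set A) :
  (forall L, P L -> ideal L) -> P L0 ->
  exists L, P L /\ forall L', P L' -> L `<=` L' -> L' `<=` L.
Proof.
move=> idP PL0; apply: contrapT => nmax.
have next (L : {L | P L}) : exists L' : {L | P L},
    sval L `<=` sval L' /\ ~ (sval L' `<=` sval L).
  apply: contrapT => nL; apply: nmax; exists (sval L); split; first exact: svalP.
  move=> L' PL' LL'; apply: contrapT => nLL'; apply: nL.
  by exists (exist _ L' PL').
have [g gP] := choice next.
pose s n := iter n g (exist _ L0 PL0).
have [||n] := @noetherian_chain (fun n => sval (s n)).
- by move=> n; apply/idP/svalP.
- by move=> n; case: (gP (s n)).
- by case: (gP (s n)).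
Qed.

End Noetherian.

End Ideals.

(** Hilbert's basis theorem, by leading monomials. In the class of [u k] modulo the ideal of the
    earlier terms, take [v k] with the smallest leading monomial. By Dickson's lemma that of some
    [v i], [i < k], divides that of [v k], and cancelling the leading term contradicts
    minimality. *)
Lemma noetherian_mpoly (F : fieldType) n : noetherian {mpoly F[n]}.
Proof.
move=> u; apply: contrapT => bad.
pose J k := generated (fun i : 'I_k => u i).
have idJ k : ideal (J k) by exact: ideal_generated.
have badk k : ~ J k (u k) by move=> gk; apply: bad; exists k.
have mini k : exists v, J k (v - u k) /\
    forall w, J k (w - u k) -> ~ (mlead w < mlead v)%O.
  have : exists v, J k (v - u k).
    by exists (u k); rewrite subrr; apply: (ideal0 (idJ k)).
  case=> v; move: {2}(mlead v) (erefl (mlead v)) => m; move: m v.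
  elim/(well_founded_ind (@ltom_wf n)) => m IH v mv Jv.
  have [[w [Jw lw]]|nw] := pselect (exists w, J k (w - u k) /\ (mlead w < mlead v)%O).
    by apply: (IH _ _ w erefl Jw); rewrite -mv.
  by exists v; split=> // w Jw lw; apply: nw; exists w.
have [v vP] := choice mini.
have v0 k : v k != 0.
  apply/eqP => v0; have [] := vP k; rewrite v0 sub0r => /(idealN (idJ k)).
  by rewrite opprK => /badk.
have [i [k [ik mik]]] := dickson (fun k => mlead (v k)).
(* [v i] is congruent to [u i] modulo [J i], and both [J i] and [u i] lie in [J k]. *)
have Jvi : J k (v i).
  have mono q : J i q -> J k q.
    apply: (generated_sub (idJ k)) => j.
    exact: (mem_generated (fun i : 'I_k => u i) (Ordinal (ltn_trans (ltn_ord j) ik))).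
  rewrite -[v i](subrK (u i)); apply: (idealD (idJ k)).
    by apply: mono; case: (vP i).
  exact: (mem_generated (fun i : 'I_k => u i) (Ordinal ik)).
(* [t] is the monomial multiple of [v i] with the same leading term as [v k]. *)
pose c := (v k)@_(mlead (v k)) / (v i)@_(mlead (v i)).
pose t := c *: (v i * 'X_[mlead (v k) - mlead (v i)]).
have c0 : c != 0 by rewrite mulf_neq0 ?invr_eq0 ?mleadc_eq0 ?v0.
have lt : mlead t = mlead (v k).
  rewrite /t mleadZ // mleadM ?v0 //; last first.
    by rewrite -msize_poly_eq0 msizeX.
  by rewrite mleadXm addmC submK.
have ct : t@_(mlead (v k)) = (v k)@_(mlead (v k)).
  rewrite mcoeffZ -[X in _@_X](submK mik) mcoeffMX.
  by rewrite /c -mulrA mulVf ?mulr1 // mleadc_eq0 v0.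
have w0 : v k - t != 0.
  apply/eqP => /subr0_eq vt; apply: (badk k).
  rewrite -[u k](subrK (v k)) -opprB vt; apply: (idealD (idJ k)).
    by rewrite -vt; apply/(idealN (idJ k)); case: (vP k).
  by rewrite /t -mul_mpolyC mulrCA; apply: (idealMr (idJ k)).
have [_ /(_ (v k - t))] := vP k; apply.
  rewrite addrAC; apply: (idealB (idJ k)); first by case: (vP k).
  by rewrite /t -mul_mpolyC mulrCA; apply: (idealMr (idJ k)).
rewrite lt_neqAle; apply/andP; split.
  apply: contraNneq w0 => lw; rewrite -mleadc_eq0 lw mcoeffB ct subrr //.
by apply: le_trans (mleadB_le _ _) _; rewrite lt joinxx.
Qed.

(** * Krull's intersection theorem at a point *)

Lemma mpoly_ring_ind (R : comNzRingType) n (P : {mpoly R[n]} -> Prop) :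
  (forall c, P c%:MP) -> (forall i, P 'X_i) ->
  (forall p q, P p -> P q -> P (p + q)) -> (forall p q, P p -> P q -> P (p * q)) ->
  forall p, P p.
Proof.
move=> PC PX PD PM p; rewrite [p]mpolyE.
apply: big_ind => [||m _]; [by rewrite -mpolyC0; apply: PC|exact: PD|].
rewrite -mul_mpolyC; apply: (PM) => //; rewrite mpolyXE_id.
have P1 : P 1 by rewrite -mpolyC1; apply: PC.
apply: big_ind => [||i _]; [exact: P1|exact: PM|].
elim: (m i) => [|k IHk]; first by rewrite expr0.
by rewrite exprS; apply: PM.
Qed.

Lemma mderivXU (R : nzRingType) n (i j : 'I_n) : ('X_j : {mpoly R[n]})^`M(i) = (i == j)%:R.
Proof.
rewrite mderivX mnm1E eq_sym; case: eqVneq => [->|]; last by rewrite scale0r.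
by rewrite scale1r -[X in (X - _)%MM]add0m addmK mpolyX0.
Qed.

Section LocalPowers.
Variables (F : fieldType) (n : nat) (p : 'I_n -> F).
Local Notation A := {mpoly F[n]}.
Implicit Types (q a b : A) (J Q : set A).

Local Notation t i := ('X_i - (p i)%:MP : A).

(* The k-th power of the maximal ideal of the point p. *)
Fixpoint mpow (k : nat) : set A :=
  if k is k'.+1 then
    [set q | exists a : 'I_n -> A, (forall i, mpow k' (a i)) /\ q = \sum_i t i * a i]
  else setT.

Lemma ideal_mpow k : ideal (mpow k).
Proof.
elim: k => [|k [IH0 IHD IHM]] //=; split.
- exists (fun=> 0); split=> // ; by rewrite big1 // => i _; rewrite mulr0.
- move=> _ _ [a [Ia ->]] [b [Ib ->]]; exists (fun i => a i + b i).
  by split=> [i|]; [apply: IHD|rewrite -big_split; apply: eq_bigr => i _; rewrite mulrDr].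
- move=> x _ [a [Ia ->]]; exists (fun i => x * a i); split=> [i|]; first exact: IHM.
  by rewrite mulr_sumr; apply: eq_bigr => i _; rewrite mulrCA.
Qed.

Lemma mpowSP k q : mpow k.+1 q ->
  exists a : 'I_n -> A, (forall i, mpow k (a i)) /\ q = \sum_i t i * a i.
Proof. by []. Qed.

Lemma mpowS k i q : mpow k q -> mpow k.+1 (t i * q).
Proof.
move=> kq; exists (fun j => if j == i then q else 0); split.
  by move=> j; case: ifP => // _; apply: (ideal0 (ideal_mpow k)).
rewrite (bigD1 i) //= eqxx big1 ?addr0 // => j /negPf ->.
by rewrite mulr0.
Qed.

Lemma mpowW k : mpow k.+1 `<=` mpow k.
Proof.
elim: k => [//|k IHk] q /mpowSP[a [Ia ->]].
by exists a; split=> // i; apply/IHk/Ia.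
Qed.

Lemma mpowM k l a b : mpow k a -> mpow l b -> mpow (k + l) (a * b).
Proof.
elim: k a => [|k IHk] a; first by move=> _ lb; apply: (idealMl (ideal_mpow l)).
move=> /mpowSP[c [Ic ->]] lb; rewrite mulr_suml; apply: (ideal_sum (ideal_mpow _)) => i _.
by rewrite -mulrA addSn; apply: mpowS; apply: IHk (Ic i) lb.
Qed.

Lemma mpow1P q : mpow 1 q <-> q.@[p] = 0.
Proof.
split.
  move=> /mpowSP[a [_ ->]]; rewrite raddf_sum big1 // => i _ /=.
  by rewrite mevalM mevalB mevalXU mevalC subrr mul0r.
suff: mpow 1 (q - (q.@[p])%:MP).
  by move=> + q0; rewrite q0 subr0.
move: q; apply: (mpoly_ring_ind (P := fun q => mpow 1 (q - (q.@[p])%:MP))) =>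
  [c|i|a b IHa IHb|a b IHa IHb].
- by rewrite mevalC subrr; apply: (ideal0 (ideal_mpow 1)).
- by rewrite mevalXU -[X in mpow _ X]mulr1; apply: mpowS.
- by rewrite mevalD mpolyCD opprD addrACA; apply: (idealD (ideal_mpow 1)).
- have -> : a * b - (a * b).@[p]%:MP =
      a * (b - b.@[p]%:MP) + (b.@[p])%:MP * (a - a.@[p]%:MP).
    by rewrite mevalM mpolyCM; ring.
  by apply: (idealD (ideal_mpow 1)); apply: (idealMl (ideal_mpow 1)).
Qed.

Lemma mpow1_sub q : mpow 1 (q - (q.@[p])%:MP).
Proof. by apply/mpow1P; rewrite mevalB mevalC subrr. Qed.

(* q is a unit modulo the maximal ideal. *)
Lemma mpow_unit J k q a : ideal J -> q.@[p] != 0 -> mpow k a ->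
  idealA J (mpow k.+1) (q * a) -> idealA J (mpow k.+1) a.
Proof.
move=> idJ q0 ka qa; have idJk := ideal_idealA idJ (ideal_mpow k.+1).
have -> : a = (q.@[p]^-1)%:MP * (q * a - (q - (q.@[p])%:MP) * a).
  rewrite mulrBl subKr mulrA -mpolyCM mulVf // mpolyC1 mul1r //.
apply: (idealMl idJk); apply: (idealB idJk) => //.
apply: idealA_subr => //; rewrite -[k.+1]add1n; apply: mpowM => //.
exact: mpow1_sub.
Qed.

Section VectorFields.
Variable c : 'I_n -> A.

(** The derivation of the polynomial ring sending each ['X_i] to [c i]. *)
Definition vfield q : A := \sum_i c i * q^`M(i).

Lemma vfieldD a b : vfield (a + b) = vfield a + vfield b.
Proof.
by rewrite /vfield -big_split; apply: eq_bigr => i _; rewrite mderivD mulrDr.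
Qed.

Lemma vfield0 : vfield 0 = 0.
Proof. by rewrite /vfield big1 // => i _; rewrite mderiv0 mulr0. Qed.

Lemma vfieldN a : vfield (- a) = - vfield a.
Proof.
by rewrite /vfield -sumrN; apply: eq_bigr => i _; rewrite mderivN mulrN.
Qed.

Lemma vfieldB a b : vfield (a - b) = vfield a - vfield b.
Proof. by rewrite vfieldD vfieldN. Qed.

Lemma vfield_sum (T : Type) (s : seq T) (P : pred T) (f : T -> A) :
  vfield (\sum_(i <- s | P i) f i) = \sum_(i <- s | P i) vfield (f i).
Proof. by apply: (big_morph _ vfieldD vfield0). Qed.

Lemma vfieldM a b : vfield (a * b) = vfield a * b + a * vfield b.
Proof.
rewrite /vfield mulr_suml mulr_sumr -big_split; apply: eq_bigr => i _ /=.
by rewrite mderivM; ring.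
Qed.

Lemma vfieldX i : vfield 'X_i = c i.
Proof.
rewrite /vfield (bigD1 i) //= mderivXU eqxx mulr1 big1 ?addr0 // => j ji.
by rewrite mderivXU (negPf ji) mulr0.
Qed.

Lemma vfieldC x : vfield x%:MP = 0.
Proof. by rewrite /vfield big1 // => i _; rewrite mderivC mulr0. Qed.

Lemma vfieldt i : vfield (t i) = c i.
Proof. by rewrite vfieldB vfieldC vfieldX subr0. Qed.

(* Modulo the next power of the maximal ideal, a vector field which agrees with
   a multiple of the Euler field to first order acts as a scalar. *)
Lemma euler_mpow (D : A) : (forall i, mpow 2 (c i - D * t i)) ->
  forall k q, mpow k q -> mpow k.+1 (vfield q - D * q *+ k).
Proof.
move=> cD; elim=> [|k IHk] q.
  move=> _; rewrite mulr0n subr0; apply: (ideal_sum (ideal_mpow 1)) => i _.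
  apply: (idealMr (ideal_mpow 1)); rewrite -[c i](subrK (D * t i)).
  apply: (idealD (ideal_mpow 1)); first exact/mpowW/cD.
  by apply: (idealMl (ideal_mpow 1)); rewrite -[X in mpow _ X]mulr1; apply: mpowS.
move=> /mpowSP[a [Ia ->]]; rewrite vfield_sum mulr_sumr -sumrMnl -sumrB.
apply: (ideal_sum (ideal_mpow k.+2)) => i _.
have -> : vfield (t i * a i) - D * (t i * a i) *+ k.+1 =
    (c i - D * t i) * a i + t i * (vfield (a i) - D * a i *+ k).
  by rewrite vfieldM vfieldt mulrSr; ring.
apply: (idealD (ideal_mpow k.+2)); last exact: mpowS (IHk _ (Ia i)).
by rewrite -[k.+2]/(2 + k)%N; apply: mpowM.
Qed.

End VectorFields.

(** If q - q(p) is the sum of the [t i * a i], then the i-th partial derivative of q is congruent to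
    [a i] modulo the maximal ideal of p. *)
Lemma taylor1 q : mpow 2 (q - (q.@[p])%:MP - \sum_i t i * q^`M(i)).
Proof.
have [a [_ qa]] := mpowSP (mpow1_sub q).
have dq i : q^`M(i) = a i + \sum_j t j * (a j)^`M(i).
  rewrite -[q](subrK (q.@[p])%:MP) mderivD mderivC addr0 qa raddf_sum /=.
  rewrite (eq_bigr (fun j => (i == j)%:R * a j + t j * (a j)^`M(i))); last first.
    by move=> j _; rewrite mderivM mderivB mderivC subr0 mderivXU.
  rewrite big_split /= (bigD1 i) //= eqxx mul1r big1 ?addr0 // => j.
  by rewrite eq_sym => /negPf ->; rewrite mul0r.
rewrite qa -sumrB; apply: (ideal_sum (ideal_mpow 2)) => i _.
rewrite dq mulrDr opprD addNKr; apply: (idealN (ideal_mpow 2)).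
by apply: mpowS; apply: (ideal_sum (ideal_mpow 1)) => j _; apply: mpowS.
Qed.

(** Pigeonhole: a product of more than [\sum_i e i] factors among the [t i] is divisible by some
    [t i ^+ e i]. *)
Lemma mpow_radical (L : set A) (e : 'I_n -> nat) : ideal L ->
  (forall i, L ((t i) ^+ e i)) -> exists k, mpow k `<=` L.
Proof.
move=> idL Le; exists (\sum_i e i).+1.
(* The induction moves linear factors from [q] into the monomial with exponents [d]; the total
   degree stays the same. *)
suff gen k q (d : 'I_n -> nat) : mpow k q -> (\sum_i e i < k + \sum_i d i)%N ->
    L ((\prod_i (t i) ^+ d i) * q).
  move=> q kq; have := gen _ _ (fun=> 0%N) kq.
  rewrite (big1 _ _ (fun i => (t i) ^+ 0)) ?mul1r; last by move=> i _; rewrite expr0.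
  by apply; rewrite ltnS leq_addr.
elim: k q d => [|k IHk] q d.
  move=> _; rewrite add0n => lt_ed.
  have [i lei] : exists i, (e i <= d i)%N.
    apply: contrapT => nle; move: lt_ed; rewrite ltnNge => /negP; apply.
    apply: leq_sum => i _; rewrite leqNgt; apply/negP => /ltnW le_ed.
    by apply: nle; exists i.
  apply: (idealMr idL); rewrite (bigD1 i) //=; apply: (idealMr idL).
  by rewrite -(subnK lei) exprD; apply: (idealMl idL).
move=> /mpowSP[a [ka ->]] lt_ed; rewrite mulr_sumr; apply: (ideal_sum idL) => i _.
pose d' j := (d j + (j == i))%N.
have sd' : (\sum_j d' j = (\sum_j d j).+1)%N.
  rewrite big_split /= -[X in _ = X]addn1; congr addn.
  by rewrite (bigD1 i) //= eqxx big1 // => j /negPf ->.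
rewrite mulrA; have -> : \prod_j (t j) ^+ d j * t i = \prod_j (t j) ^+ d' j.
  rewrite (bigD1 i) //= [RHS](bigD1 i) //= mulrAC -exprSr /d' eqxx addn1.
  by congr (_ * _); apply: eq_bigr => j /negPf ->; rewrite addn0.
by apply: IHk => //; rewrite sd' addnS -addSn.
Qed.

(* Among the ideals containing J + m q but no more of J + (q), m the maximal
   ideal of p, a maximal one L contains a power of m, hence q. *)
Lemma krull_intersection J q : ideal J -> (forall k, idealA J (mpow k) q) ->
  exists s, s.@[p] != 0 /\ J (s * q).
Proof.
move=> idJ Jq; pose N := idealA J (principal q).
(* [N'] is J + m q, membership in m being expressed by [b.@[p] = 0]. *)
pose N' := [set y | exists a b, [/\ J a, b.@[p] = 0 & y = a + b * q]].
have idN : ideal N by apply: ideal_idealA => //; apply: ideal_principal.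
have idN' : ideal N'.
  split.
  - by exists 0, 0; rewrite meval0 mul0r addr0; split=> //; apply: (ideal0 idJ).
  - move=> _ _ [a [b [Ja b0 ->]]] [c [d [Jc d0 ->]]]; exists (a + c), (b + d).
    by rewrite mevalD b0 d0 addr0 mulrDl addrACA; split=> //; apply: (idealD idJ).
  - move=> x _ [a [b [Ja b0 ->]]]; exists (x * a), (x * b).
    by rewrite mevalM b0 mulr0 mulrDr mulrA; split=> //; apply: (idealMl idJ).
have tN i y : N y -> N' (t i * y).
  move=> [a [_ [Ja [b ->] ->]]]; exists (t i * a), (t i * b); split.
  - exact: (idealMl idJ).
  - by rewrite mevalM mevalB mevalXU mevalC subrr mul0r.
  - by rewrite mulrDr mulrA.
have [] := noetherian_maximal (@noetherian_mpoly F n)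
  (P := [set L | [/\ ideal L, N' `<=` L & forall y, L y -> N y -> N' y]]) (L0 := N').
- by move=> L [].
- by split.
move=> L [[idL N'L LN] maxL].
have tpow i : exists e, L ((t i) ^+ e).
  (* The ideals L : t_i^e become stationary at some e. Then adding t_i^e to L creates no new element
     of [N] outside [N'], so maximality puts t_i^e in L. *)
  pose chain e := [set y | L ((t i) ^+ e * y)].
  have [|e|e eP] := noetherian_chain (@noetherian_mpoly F n) (L := chain).
  - move=> e; split; rewrite /chain /=.
    + by rewrite mulr0; apply: (ideal0 idL).
    + by move=> a b; rewrite mulrDr; apply: (idealD idL).
    + by move=> a b; rewrite mulrCA; apply: (idealMl idL).
  - by move=> y; rewrite /chain /= exprS -mulrA; apply: (idealMl idL).
  exists e; apply: (maxL (idealA L (principal ((t i) ^+ e)))); first split.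
  - by apply: ideal_idealA => //; apply: ideal_principal.
  - by apply: subset_trans N'L _; apply/idealA_subl/ideal_principal.
  - move=> y [l [_ [Ll [a ->] ->]]] Ny; apply: LN => //.
    apply: (idealD idL) => //; rewrite mulrC; apply: eP; rewrite /chain /=.
    have := N'L _ (tN i _ Ny); rewrite mulrDr => /(idealB idL).
    move=> /(_ _ (idealMl idL (t i) Ll)); rewrite addrC addKr.
    by rewrite exprS -mulrA [a * _]mulrC.
  - exact/idealA_subl/ideal_principal.
  - by apply: idealA_subr => //; apply: mem_principal.
have [e eP] := choice tpow; have [k mL] := mpow_radical idL eP.
have Lq : L q.
  have [a [b [Ja kb ->]]] := Jq k; apply: (idealD idL); last exact: mL.
  by apply: N'L; exists a, 0; rewrite meval0 mul0r addr0.
(* As q lies in both L and [N], it lies in [N']: q = a + b q with b(p) = 0, and the multiplier is 1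
   - b. *)
have [] := LN q Lq; first exact/(idealA_subr idJ)/mem_principal.
move=> a [b [Ja b0 qab]]; exists (1 - b); rewrite mevalB meval1 b0 subr0 oner_eq0.
by split=> //; rewrite mulrBl mul1r {1}qab addrK.
Qed.

(** [Q] has finitely many generators; the multipliers obtained for them are multiplied together. *)
Lemma krull_intersection_ideal J Q : ideal J -> ideal Q ->
  (forall k, Q `<=` idealA J (mpow k)) ->
  exists s, s.@[p] != 0 /\ forall q, Q q -> J (s * q).
Proof.
move=> idJ idQ QJ.
have [r [f [Qf Qgen]]] := noetherian_finite (@noetherian_mpoly F n) idQ.
have [|s sP] := choice (_ : forall i, exists s, s.@[p] != 0 /\ J (s * f i)).
  by move=> i; apply: krull_intersection => // k; apply/QJ/Qf.
exists (\prod_i s i); split.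
  by rewrite rmorph_prod; apply/prodf_neq0 => i _; case: (sP i).
move=> q /Qgen[a ->]; rewrite mulr_sumr; apply: (ideal_sum idJ) => i _.
rewrite mulrCA; apply: (idealMl idJ); rewrite (bigD1 i) //= mulrAC.
by apply: (idealMr idJ); case: (sP i).
Qed.

End LocalPowers.

(** * Ideals stable under derivations *)

Section DifferentialIdeals.
Variables (F : numFieldType) (n : nat) (p : 'I_n -> F).
Local Notation A := {mpoly F[n]}.
Local Notation t i := ('X_i - (p i)%:MP : A).
Variables (f : 'I_n -> A) (E : pred 'I_n).

Let M : 'M[A]_n := \matrix_(i, j) (f i)^`M(j).

(* The vector fields dual to the local coordinates f, up to the factor \det M. *)
Definition dual_field (e : 'I_n) : A -> A := vfield (fun k => (\adj M) k e).

Lemma dual_fieldE i e : dual_field e (f i) = \det M *+ (i == e).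
Proof.
transitivity ((M *m \adj M) i e); last by rewrite mul_mx_adj mxE.
by rewrite mxE; apply: eq_bigr => k _; rewrite [M _ _]mxE mulrC.
Qed.

Hypotheses (f0 : forall i, (f i).@[p] = 0) (M0 : (\det M).@[p] != 0).

(** The coefficients of the Euler field of the local coordinates [f], up to the factor [\det M]. *)
Let ec k : A := \sum_i f i * (\adj M) k i.

Lemma euler_dual_field q : vfield ec q = \sum_i f i * dual_field i q.
Proof.
rewrite /vfield; under eq_bigr do rewrite mulr_suml.
rewrite exchange_big; apply: eq_bigr => i _ /=.
by rewrite mulr_sumr; apply: eq_bigr => k _; rewrite mulrA.
Qed.

(** To first order [f i] is the sum of the [t l] times its partial derivatives, and [\adj M *m M] is
    the scalar matrix [\det M]. *)
Lemma euler_coef k : mpow p 2 (ec k - \det M * t k).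
Proof.
have -> : ec k - \det M * t k =
    \sum_i (\adj M) k i * (f i - \sum_l t l * (f i)^`M(l)).
  have -> : \det M * t k = \sum_l (\adj M *m M) k l * t l.
    rewrite mul_adj_mx (bigD1 k) //= !mxE eqxx mulr1n big1 ?addr0 //.
    by move=> l; rewrite eq_sym => /negPf lk; rewrite !mxE lk mulr0n mul0r.
  rewrite /ec; under [X in _ - X]eq_bigr do rewrite mxE mulr_suml.
  rewrite exchange_big -sumrB; apply: eq_bigr => i _ /=.
  rewrite mulrBr mulrC; congr (_ - _); rewrite mulr_sumr; apply: eq_bigr => l _.
  by rewrite !mxE -mulrA [X in _ * X]mulrC.
apply: (ideal_sum (ideal_mpow p 2)) => i _; apply: (idealMl (ideal_mpow p 2)).
by have := taylor1 p (f i); rewrite f0 subr0.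
Qed.

(** By Krull it suffices to show that Q lies in J + m^k for all k. If q = j + a with j in J and a in
    m^k, the Euler field multiplies a by k [\det M] modulo m^(k+1). It is also the sum of the
    [f i * dual_field i]: the terms outside [E] lie in J, and for the others stability and induction
    give one more order of vanishing. *)
Lemma differential_ideal (J Q : set A) (u : A) :
  ideal J -> (forall i, ~~ E i -> J (f i)) ->
  (forall e a, E e -> J a -> J (dual_field e a)) ->
  ideal Q -> (forall q, Q q -> q.@[p] = 0) -> u.@[p] != 0 ->
  (forall e q, E e -> Q q -> Q (u * dual_field e q)) ->
  exists s, s.@[p] != 0 /\ forall q, Q q -> J (s * q).
Proof.
move=> idJ Jf JD idQ Q0 u0 QD; apply: (krull_intersection_ideal idJ idQ).
have idJm k := ideal_idealA idJ (ideal_mpow p k).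
(* The Euler argument divides by the degree, which is zero at the start; the passage to order 1 uses
   instead that Q vanishes at p. *)
elim=> [|[_|k IHk]] q Qq; first exact: idealA_subr.
  by apply: idealA_subr => //; apply/mpow1P/Q0.
have [j [m [Jj km qjm]]] := IHk q Qq.
rewrite qjm; apply: (idealD (idJm _)); first exact/idealA_subl/Jj/ideal_mpow.
(* This multiplier does not vanish at p because the characteristic is 0. *)
apply: (@mpow_unit _ _ _ _ _ (u * \det M *+ k.+1)) => //.
  by rewrite mevalMn mulrn_eq0 /= mevalM mulf_neq0.
have -> : u * \det M *+ k.+1 * m =
    u * vfield ec m - u * (vfield ec m - \det M * m *+ k.+1).
  by rewrite mulrBr subKr mulrnAl mulrnAr mulrA.
apply: (idealB (idJm _)); last first.
  apply: (idealMl (idJm _)); apply: idealA_subr => //.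
  exact: (euler_mpow euler_coef).
rewrite euler_dual_field mulr_sumr; apply: (ideal_sum (idJm _)) => i _.
have [Ei|nEi] := boolP (E i); last first.
  by apply/idealA_subl/(idealMl idJ)/(idealMr idJ)/Jf/nEi/ideal_mpow.
have -> : u * (f i * dual_field i m) =
    f i * (u * dual_field i q) - u * f i * dual_field i j.
  by rewrite qjm /dual_field vfieldD; ring.
apply: (idealB (idJm _)); last first.
  by apply/idealA_subl/(idealMl idJ)/JD => //; apply: ideal_mpow.
have [a [b [Ja kb ->]]] := IHk _ (QD i q Ei Qq); rewrite mulrDr.
apply: (idealD (idJm _)); first exact/idealA_subl/(idealMl idJ)/Ja/ideal_mpow.
apply: idealA_subr => //; rewrite -[k.+2]add1n; apply: mpowM => //.
exact/mpow1P.
Qed.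

End DifferentialIdeals.

(** * Vanishing ideals of constant Jacobian rank *)

Definition mjac (F : fieldType) n r (f : 'I_r -> {mpoly F[n]}) (p : 'I_n -> F) :
  'M[F]_(r, n) := \matrix_(i, j) (f i)^`M(j).@[p].

Definition mdiff (F : fieldType) n (f : {mpoly F[n]}) (p v : 'I_n -> F) : F :=
  \sum_j v j * f^`M(j).@[p].

Definition mvanish (F : fieldType) n (X : set ('I_n -> F)) : set {mpoly F[n]} :=
  [set f | forall p, X p -> f.@[p] = 0].

Lemma ideal_mvanish (F : fieldType) n (X : set ('I_n -> F)) : ideal (mvanish X).
Proof.
split=> [p _|a b Ia Ib p Xp|a b Ib p Xp]; first by rewrite meval0.
  by rewrite mevalD Ia // Ib // addr0.
by rewrite mevalM Ib // mulr0.
Qed.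

Lemma unitmx_completion (F : fieldType) r d (W : 'M[F]_(r, r + d)) :
  row_free W -> exists B : 'M[F]_(d, r + d), col_mx W B \in unitmx.
Proof.
move=> freeW; have rkC : \rank (W^C)%MS = d.
  by rewrite mxrank_compl (eqP freeW) addKn.
exists (castmx (rkC, erefl) (row_base (W^C)%MS)).
rewrite -row_full_unit -sub1mx -addsmxE.
apply: submx_trans (_ : (W + W^C <= _)%MS); first by rewrite sub1mx addsmx_compl_full.
by apply: addsmxS => //; rewrite eqmx_cast eq_row_base.
Qed.

Lemma row_free_col_mx (F : fieldType) r n (w : 'rV[F]_n) (W : 'M[F]_(r, n)) :
  row_free W -> ~~ (w <= W)%MS -> row_free (col_mx w W).
Proof.
move=> freeW wW; rewrite /row_free eqn_leq rank_leq_row /=.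
suff : (\rank W < \rank (w + W)%MS)%N by rewrite (eqP freeW) addsmxE.
apply: rank_ltmx; rewrite /ltmx addsmxSr /=.
by apply: contra wW; apply: submx_trans (addsmxSl _ _).
Qed.

Lemma row_free_usubmx (F : fieldType) r d n (N : 'M[F]_(r + d, n)) :
  row_free N -> row_free (usubmx N).
Proof.
rewrite /row_free => /eqP freeN; rewrite eqn_leq rank_leq_row /=.
rewrite -(leq_add2r d) -{1}freeN -{1}[N]vsubmxK -addsmxE.
by apply: leq_trans (mxrank_adds_leqif _ _) _; rewrite leq_add2l rank_leq_row.
Qed.

(** Equivalently, the Zariski tangent space of X has codimension at most [r] at each point of X in
    U. *)
Definition rank_bounded (F : fieldType) n r (X U : set ('I_n -> F)) :=
  forall p, X p -> U p -> forall g : 'I_r.+1 -> {mpoly F[n]},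
    (forall i, mvanish X (g i)) -> ~~ row_free (mjac g p).

Definition tangent_constant (F : fieldType) n (X : set ('I_n -> F)) (q : {mpoly F[n]}) :=
  forall p, X p -> forall v, (forall g, mvanish X g -> mdiff g p v = 0) ->
    mdiff q p v = 0.

(** Complete [f] to local coordinates at p. The dual fields of the added coordinates kill [f]. By
    the rank bound, differentials of members of the ideal I of X are combinations of those of [f],
    so these fields preserve I + (q - q(p)) up to a factor nonzero at p. Then [differential_ideal]
    compares this ideal with the one generated by [f]. *)
Lemma constant_rank (F : numFieldType) n (X : set ('I_n -> F)) p r
    (f : 'I_r -> {mpoly F[n]}) (s q : {mpoly F[n]}) : X p ->
  (forall i, mvanish X (f i)) -> row_free (mjac f p) ->
  s.@[p] != 0 -> rank_bounded r X [set p' | s.@[p'] != 0] -> tangent_constant X q ->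
  exists s', [/\ s'.@[p] != 0, forall g, mvanish X g -> generated f (s' * g)
    & generated f (s' * (q - (q.@[p])%:MP))].
Proof.
set I := mvanish X; move=> Xp If freef s0 maxr tq.
have [d nE] : exists d, n = (r + d)%N.
  exists (n - r)%N; rewrite subnKC //.
  by rewrite -(eqP freef) rank_leq_col.
subst n; have [B unitB] := unitmx_completion freef.
(* Affine functions vanishing at p, with the rows of [B] as differentials. *)
pose g (j : 'I_d) : {mpoly F[r + d]} := \sum_k (B j k)%:MP * ('X_k - (p k)%:MP).
pose c (i : 'I_(r + d)) : {mpoly F[r + d]} :=
  match split i with inl j => f j | inr j => g j end.
have cl j : c (lshift d j) = f j by rewrite /c (unsplitK (inl j)).
have cr j : c (rshift r j) = g j by rewrite /c (unsplitK (inr j)).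
pose M : 'M[{mpoly F[r + d]}]_(r + d) := \matrix_(i, j) (c i)^`M(j).
have dg k j : (g k)^`M(j) = (B k j)%:MP.
  rewrite /g raddf_sum (bigD1 j) //= big1 => [|l lj].
    by rewrite mderiv_mulC mderivB mderivC subr0 mderivXU eqxx mulr1 addr0.
  by rewrite mderiv_mulC mderivB mderivC subr0 mderivXU eq_sym (negPf lj) mulr0.
have Mp : map_mx (meval p) M = col_mx (mjac f p) B.
  apply/matrixP => i j; rewrite -(splitK i); case: (split i) => k /=.
    by rewrite col_mxEu !mxE cl.
  by rewrite col_mxEd !mxE cr dg mevalC.
have detM0 : (\det M).@[p] != 0 by rewrite -det_map_mx Mp -unitfE -unitmxE.
(* The indices of the added coordinates [g]. *)
pose E : pred 'I_(r + d) := fun i => (r <= i)%N.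
pose D := dual_field c.
have Df i e : E e -> D e (f i) = 0.
  move=> Ee; rewrite -cl /D dual_fieldE; case: eqVneq Ee => [<-|]; last by [].
  by rewrite /E /= leqNgt ltn_ord.
have DE e h p' : (D e h).@[p'] = mdiff h p' (fun j => ((\adj M) j e).@[p']).
  rewrite /D /dual_field /vfield raddf_sum; apply: eq_bigr => j _.
  exact: mevalM.
have kerD e p' h : X p' -> s.@[p'] != 0 -> (\det M).@[p'] != 0 -> E e -> I h ->
    (D e h).@[p'] = 0.
  move=> Xp' sp' Mp' Ee Ih.
  have freef' : row_free (mjac f p').
    have -> : mjac f p' = usubmx (map_mx (meval p') M).
      by apply/matrixP => i j; rewrite !mxE cl.
    by apply: row_free_usubmx; rewrite row_free_unit unitmxE unitfE det_map_mx.
  pose v : 'cV[F]_(r + d) := \col_j ((\adj M) j e).@[p'].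
  have mulv (b : {mpoly F[r + d]}) : (\row_j (b^`M(j)).@[p'] *m v) 0 0 = (D e b).@[p'].
    rewrite DE mxE; apply: eq_bigr => j _.
    by rewrite [X in X * _]mxE [v _ _]mxE mulrC.
  pose dh : 'rV[F]_(r + d) := \row_j (h^`M(j)).@[p'].
  have /submxP[a dha] : (dh <= mjac f p')%MS.
    (* Otherwise [h] and the [f i] would be r + 1 members of I with independent differentials at
       [p']. *)
    apply: contraT => ndh.
    pose hf (i : 'I_(1 + r)) : {mpoly F[r + d]} :=
      match split i with inl _ => h | inr j => f j end.
    have Ihf i : I (hf i) by rewrite /hf; case: (split i).
    have := maxr p' Xp' sp' hf Ihf.
    rewrite (_ : mjac hf p' = col_mx dh (mjac f p')) ?row_free_col_mx //.
    apply/matrixP => i j; rewrite -(splitK i); case: (split i) => k /=.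
      by rewrite col_mxEu !mxE /hf (unsplitK (inl k)).
    by rewrite col_mxEd !mxE /hf (unsplitK (inr k)).
  rewrite -mulv -/dh dha -mulmxA (_ : _ *m v = 0) ?mulmx0 ?mxE //.
  apply/matrixP => i k; rewrite ord1 [RHS]mxE -[RHS](meval0 p') -(Df i e Ee) -mulv.
  rewrite mxE [RHS]mxE; apply: eq_bigr => j _.
  by rewrite [X in X * _]mxE [in RHS]mxE.
pose q0 := q - (q.@[p])%:MP; pose u := s * \det M.
have uI e h : E e -> (forall p', X p' -> s.@[p'] != 0 -> (\det M).@[p'] != 0 ->
    (D e h).@[p'] = 0) -> I (u * D e h).
  move=> Ee hD p' Xp'; rewrite !mevalM.
  have [->|sp'] := eqVneq s.@[p'] 0; first by rewrite !mul0r.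
  have [->|Mp'] := eqVneq (\det M).@[p'] 0; first by rewrite mulr0 mul0r.
  by rewrite hD // mulr0.
have idI := ideal_mvanish X; have idg := ideal_generated f.
have [|||||||||s' [s'0 s'P]] := @differential_ideal _ _ p c E _ _ (generated f)
    (idealA I (principal q0)) u.
- move=> i; rewrite -(splitK i); case: (split i) => k /=; first by rewrite cl If.
  rewrite cr /g raddf_sum big1 // => l _ /=.
  by rewrite mevalM mevalB mevalXU (mevalC p (p l)) subrr mulr0.
- exact: detM0.
- exact: idg.
- move=> i; rewrite -(splitK i); case: (split i) => k /=; rewrite /E.
    by rewrite cl => _; apply: mem_generated.
  by rewrite /= leq_addr.
- move=> e _ Ee [a ->]; rewrite /dual_field vfield_sum; apply: (ideal_sum idg) => i _.
  rewrite vfieldM -/(dual_field c e _) -/(dual_field c e _) [X in _ + _ * X]Df //.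
  by rewrite mulr0 addr0; apply/(idealMl idg)/mem_generated.
- exact/ideal_idealA/ideal_principal.
- move=> _ [a [_ [Ia [b ->] ->]]].
  by rewrite mevalD Ia // mevalM mevalB mevalC subrr mulr0 addr0.
- by rewrite mevalM mulf_neq0.
- move=> e _ Ee [a [_ [Ia [b ->] ->]]].
  have Dq0 : I (u * D e q0).
    apply: uI => // p' Xp' sp' Mp'; rewrite /q0 /D /dual_field vfieldB vfieldC subr0.
    rewrite -/(dual_field c e q) -/(D e q) DE; apply: tq => // h Ih.
    by rewrite -DE; apply: kerD.
  exists (u * D e a + b * (u * D e q0)), (u * D e b * q0); split.
  + apply: (idealD idI); last exact: (idealMl idI).
    by apply: uI => // p' Xp' sp' Mp'; apply: kerD.
  + by exists (u * D e b).
  + by rewrite /D /dual_field vfieldD vfieldM; ring.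
exists s'; split=> // [h Ih|]; apply: s'P.
  exact/idealA_subl/Ih/ideal_principal.
exact/(idealA_subr idI)/mem_principal.
Qed.


(** * Functions with zero differential on a variety *)

Section LocallyConstant.
Variables (F : numFieldType) (n : nat) (X : set ('I_n -> F)).
Local Notation A := {mpoly F[n]}.
Local Notation I := (mvanish X).

Let ranked p r := exists2 f : 'I_r -> A, forall i, I (f i) & row_free (mjac f p).

Let ranked_le p r : ranked p r -> (r <= n)%N.
Proof. by case=> f _ /eqP <-; apply: rank_leq_col. Qed.

Let max_ranked (P : set ('I_n -> F)) : (exists p, P p) ->
  exists r p, [/\ P p, ranked p r & forall p', P p' -> ~ ranked p' r.+1].
Proof.
move=> [p0 Pp0].
have ex0 : exists r, `[< exists2 p, P p & ranked p r >].
  exists 0%N; apply/asboolP; exists p0 => //.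
  by exists (fun=> 0) => [[]//|]; rewrite /row_free -leqn0 rank_leq_row.
have ub r : `[< exists2 p, P p & ranked p r >] -> (r <= n)%N.
  by move=> /asboolP[p _ /ranked_le].
case: (ex_maxnP ex0 ub) => r /asboolP[p Pp rp] maxr; exists r, p; split=> // p' Pp' rp'.
have : (r.+1 <= r)%N by apply: maxr; apply/asboolP; exists p'.
by rewrite ltnn.
Qed.

(** Among the points of X with w nonzero, choose one where the Jacobian rank is maximal; the rank
    bound then holds on the whole open set, and [constant_rank] applies. *)
Let dense_constant q w : tangent_constant X q -> ~ I w ->
  exists p u, [/\ X p, w.@[p] != 0, u.@[p] != 0 & I (u * (q - (q.@[p])%:MP))].
Proof.
move=> tq nIw; have [|r [p [[Xp wp] [f If freef] maxr]]] :=
    max_ranked (P := X `&` [set p | w.@[p] != 0]).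
  apply: contrapT => nex; apply: nIw => p Xp; apply/eqP/negPn/negP => wp.
  by apply: nex; exists p.
have [|s [s0 _ sq]] := @constant_rank _ _ X p r f w q Xp If freef wp _ tq.
  move=> p' Xp' wp' g Ig; apply/negP => freeg; apply: (maxr p') => //.
  by exists g.
exists p, s; split=> //; exact: generated_sub (ideal_mvanish X) _ _ If _ sq.
Qed.

(* By noetherianity, q takes finitely many values on a dense subset of X. *)
Lemma locally_constant q p : tangent_constant X q -> X p ->
  exists u, u.@[p] != 0 /\ I (u * (q - (q.@[p])%:MP)).
Proof.
move=> tq Xp.
(* The functions that vanish on X off finitely many fibers of [q]. The values attached to a finite
   set of generators form the list [vals]. *)
pose L : set A := [set w | exists s : seq F,
  forall p, X p -> q.@[p] \notin s -> w.@[p] = 0].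
have idL : ideal L.
  split; first by exists [::] => p' _ _; rewrite meval0.
  - move=> a b [s sa] [s' sb]; exists (s ++ s') => p' Xp'.
    by rewrite mem_cat negb_or => /andP[? ?]; rewrite mevalD sa // sb // addr0.
  - by move=> a b [s sb]; exists s => p' Xp' ?; rewrite mevalM sb // mulr0.
have [r [f [Lf genL]]] := noetherian_finite (@noetherian_mpoly F n) idL.
have [s sP] := choice Lf; pose vals := flatten [seq s i | i : 'I_r].
have valsP p' u : X p' -> u.@[p'] != 0 -> I (u * (q - (q.@[p'])%:MP)) ->
    q.@[p'] \in vals.
  move=> Xp' up' Iu; apply: contraNT up' => nvals.
  (* If [q.@[p']] were not in [vals], all the generators of [L], hence also [u], would vanish at
     [p']. *)
  have /genL[a ->] : L u.
    exists [:: q.@[p']] => p'' Xp''; rewrite inE => qq.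
    apply/eqP; have := Iu p'' Xp''; rewrite mevalM mevalB mevalC => /eqP.
    by rewrite mulf_eq0 subr_eq0 (negPf qq) orbF.
  rewrite raddf_sum big1 // => i _ /=; rewrite mevalM (sP i) ?mulr0 //.
  by apply: contra nvals => qi; apply/flattenP; exists (s i) => //;
    apply: map_f; rewrite mem_enum.
(* Otherwise the product is nonzero at a point of X near which [q] is constant, but the value of [q]
   there is in [vals]. *)
have vanP : I (\prod_(c <- vals) (q - c%:MP)).
  apply: contrapT => /(dense_constant tq)[p' [u [Xp' + up' Iu]]].
  rewrite rmorph_prod /= (big_rem _ (valsP _ _ Xp' up' Iu)) /=.
  by rewrite mevalB mevalC subrr mul0r eqxx.
(* Dropping the factors for the value at [p] leaves a function nonzero at [p] which vanishes on X
   wherever [q] takes another value. *)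
exists (\prod_(c <- vals | c != q.@[p]) (q - c%:MP)); split.
  rewrite rmorph_prod /= prodf_seq_neq0; apply/allP => c _; apply/implyP => cq.
  by rewrite mevalB mevalC subr_eq0 eq_sym.
move=> p' Xp'; rewrite mevalM mevalB mevalC.
have [->|qq] := eqVneq q.@[p'] q.@[p]; first by rewrite subrr mulr0.
have /eqP := vanP p' Xp'; rewrite rmorph_prod /= prodf_seq_eq0 => /hasP[c cv /=].
rewrite mevalB mevalC subr_eq0 => /eqP qc; move: cv; rewrite -qc => cv.
by rewrite rmorph_prod /= (big_rem _ cv) /= qq mevalB mevalC subrr !mul0r.
Qed.

(** If no nearby point of X has larger Jacobian rank than p, [constant_rank] with q = 0 gives local
    generators with independent differentials. *)
Lemma smooth_of_rank p s : X p -> s.@[p] != 0 ->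
  (forall p' r (g : 'I_r -> A), X p' -> s.@[p'] != 0 -> (forall i, I (g i)) ->
     row_free (mjac g p') ->
   exists2 f : 'I_r -> A, forall i, I (f i) & row_free (mjac f p)) ->
  exists r (f : 'I_r -> A) s', [/\ forall i, I (f i), s'.@[p] != 0,
    forall q, I q -> generated f (s' * q) & row_free (mjac f p)].
Proof.
move=> Xp sp rankp.
have [|r [_ [-> [f If freef] maxr]]] := max_ranked (P := [set p]); first by exists p.
have [||s' [s'0 s'I _]] := @constant_rank _ _ X p r f s 0 Xp If freef sp.
- move=> p' Xp' sp' g Ig; apply/negP => freeg; apply: (maxr p) => //.
  exact: rankp freeg.
- move=> p' Xp' v _; rewrite /mdiff big1 // => i _.
  by rewrite mderiv0 meval0 mulr0.
by exists r, f, s'.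
Qed.

End LocallyConstant.

(** * Tangent spaces and smoothness *)

Lemma mderiv_comp (R : comNzRingType) n m (g : n.-tuple {mpoly R[m]}) j
    (p : {mpoly R[n]}) :
  (p \mPo g)^`M(j) = \sum_i (p^`M(i) \mPo g) * (tnth g i)^`M(j).
Proof.
move: p; apply: mpoly_ring_ind => [c|i|p q IHp IHq|p q IHp IHq].
- rewrite comp_mpolyC mderivC big1 // => i _.
  by rewrite mderivC comp_mpoly0 mul0r.
- rewrite comp_mpolyXU -tnth_nth (bigD1 i) //= mderivXU eqxx comp_mpoly1 mul1r.
  rewrite big1 ?addr0 // => k ki.
  by rewrite mderivXU (negPf ki) comp_mpoly0 mul0r.
- rewrite comp_mpolyD mderivD IHp IHq -big_split; apply: eq_bigr => i _.
  by rewrite mderivD comp_mpolyD mulrDl.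
- rewrite rmorphM mderivM IHp IHq mulr_suml mulr_sumr -big_split.
  by apply: eq_bigr => i _; rewrite /= mderivM comp_mpolyD !rmorphM /=; ring.
Qed.

(** * Polynomial functions in coordinates *)

Section PolynomialFunctions.
Variables (K : fieldType) (V : vectType K).
Local Notation A := {mpoly K[\dim {:V}]}.
Implicit Types (f g : A) (p v : V).

Lemma crd_vbasis p : p = \sum_i crd p i *: (vbasis {:V})`_i.
Proof. exact: coord_vbasis (memvf p). Qed.

Lemma crd_linear i : linear_for *%R (fun p : V => crd p i).
Proof. by move=> a u v; rewrite /crd linearP. Qed.

Lemma crdD u v i : crd (u + v) i = crd u i + crd v i.
Proof. by rewrite -[u]scale1r crd_linear mul1r scale1r. Qed.

Lemma crdZ a v i : crd (a *: v) i = a * crd v i.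
Proof. by rewrite -[a *: v]addr0 crd_linear /crd linear0 addr0. Qed.

Lemma crdN v i : crd (- v) i = - crd v i.
Proof. by rewrite -scaleN1r crdZ mulN1r. Qed.

Lemma crd0 i : crd (0 : V) i = 0.
Proof. by rewrite /crd linear0. Qed.

Lemma crd_inj u v : crd u =1 crd v -> u = v.
Proof.
by move=> uv; rewrite (crd_vbasis u) (crd_vbasis v); apply: eq_bigr => i _; rewrite uv.
Qed.

Lemma crd_surj (c : 'I_(\dim {:V}) -> K) : exists v, crd v =1 c.
Proof.
exists (\sum_i c i *: (vbasis {:V})`_i) => i.
by rewrite /crd coord_sum_free // (basis_free (vbasisP _)).
Qed.

Lemma pevalM f g p : peval (f * g) p = peval f p * peval g p.
Proof. exact: mevalM. Qed.

Lemma pevalD f g p : peval (f + g) p = peval f p + peval g p.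
Proof. exact: mevalD. Qed.

Lemma peval_sum (T : Type) (s : seq T) (P : pred T) (F : T -> A) p :
  peval (\sum_(i <- s | P i) F i) p = \sum_(i <- s | P i) peval (F i) p.
Proof. exact: raddf_sum. Qed.

Lemma pdiffE f p v : pdiff f p v = (vfield (fun i => (crd v i)%:MP) f).@[crd p].
Proof.
by rewrite /vfield raddf_sum; apply: eq_bigr => i _; rewrite /= mevalM mevalC.
Qed.

Lemma pdiffD f g p v : pdiff (f + g) p v = pdiff f p v + pdiff g p v.
Proof. by rewrite !pdiffE vfieldD mevalD. Qed.

Lemma pdiffB f g p v : pdiff (f - g) p v = pdiff f p v - pdiff g p v.
Proof. by rewrite !pdiffE vfieldB mevalB. Qed.

Lemma pdiffC c p v : pdiff (c%:MP) p v = 0.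
Proof. by rewrite pdiffE vfieldC meval0. Qed.

Lemma pdiffM f g p v :
  pdiff (f * g) p v = pdiff f p v * peval g p + peval f p * pdiff g p v.
Proof. by rewrite !pdiffE vfieldM mevalD !mevalM. Qed.

Lemma pdiff_sum (T : Type) (s : seq T) (P : pred T) (F : T -> A) p v :
  pdiff (\sum_(i <- s | P i) F i) p v = \sum_(i <- s | P i) pdiff (F i) p v.
Proof.
by rewrite pdiffE vfield_sum raddf_sum; apply: eq_bigr => i _; rewrite pdiffE.
Qed.

Lemma pdiff_linear f p : linear_for *%R (pdiff f p).
Proof.
move=> a u v; rewrite /pdiff mulr_sumr -big_split; apply: eq_bigr => i _ /=.
by rewrite (crd_linear i) mulrDl mulrA.
Qed.

Definition plin (l : V -> K) : A :=
  \sum_(i < \dim {:V}) (l (vbasis {:V})`_i)%:MP * 'X_i.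

Section Plin.
Variables (l : V -> K) (lP : linear_for *%R l).

Lemma linear_forE p : l p = \sum_i crd p i * l (vbasis {:V})`_i.
Proof.
pose l' : {linear V -> K^o} := HB.pack l (GRing.isLinear.Build K V K^o *:%R l lP).
rewrite -[LHS]/(l' p) {1}(crd_vbasis p) linear_sum.
by apply: eq_bigr => i _; rewrite linearZ.
Qed.

Lemma peval_plin p : peval (plin l) p = l p.
Proof.
rewrite linear_forE peval_sum; apply: eq_bigr => i _.
by rewrite pevalM /peval mevalC mevalXU mulrC.
Qed.

Lemma pdiff_plin p v : pdiff (plin l) p v = l v.
Proof.
rewrite linear_forE pdiff_sum; apply: eq_bigr => i _.
rewrite pdiffM pdiffC mul0r add0r /peval mevalC mulrC; congr (_ * _).
by rewrite pdiffE vfieldX mevalC.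
Qed.

End Plin.

End PolynomialFunctions.

(* Linear identities between vectors are checked coordinatewise. *)
Ltac vect_ring := apply: crd_inj => ?; rewrite !(crdD, crdN, crdZ, crd0); ring.

Section Pullback.
Variables (K : fieldType) (V W : vectType K) (L : V -> W) (LP : linear L).
Implicit Types (f : {mpoly K[\dim {:W}]}) (p v : V) (X : set V) (Y : set W).

Let crdL i : linear_for *%R (fun p => crd (L p) i).
Proof. by move=> a u v; rewrite LP (crd_linear i). Qed.

Definition pullback f : {mpoly K[\dim {:V}]} :=
  f \mPo [tuple plin (fun p => crd (L p) i) | i < _].

Lemma peval_pullback f p : peval (pullback f) p = peval f (L p).
Proof.
rewrite /peval comp_mpoly_meval; apply: meval_eq => i.
by rewrite tnth_mktuple; apply: (peval_plin (crdL i)).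
Qed.

Lemma pdiff_pullback f p v : pdiff (pullback f) p v = pdiff f (L p) (L v).
Proof.
rewrite /pdiff /ppartial; under eq_bigr do rewrite mderiv_comp raddf_sum mulr_sumr.
rewrite exchange_big; apply: eq_bigr => i _ /=.
rewrite -(pdiff_plin (crdL i) p v) /pdiff mulr_suml; apply: eq_bigr => j _.
rewrite mevalM tnth_mktuple mulrCA mulrC; congr (_ * _).
exact: peval_pullback.
Qed.

Lemma vanishing_pullback X Y f : (forall p, X p -> Y (L p)) ->
  vanishing_ideal Y f -> vanishing_ideal X (pullback f).
Proof. by move=> XY If p Xp; rewrite peval_pullback; apply/If/XY. Qed.

(** A linear map is its own differential, and pulling back along it carries the ideal of Y into that
    of X. *)
Lemma tangent_space_image X Y p v : (forall p, X p -> Y (L p)) ->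
  tangent_space X p v -> tangent_space Y (L p) (L v).
Proof.
by move=> XY Tv f If; rewrite -pdiff_pullback; apply/Tv/(vanishing_pullback XY).
Qed.

End Pullback.

Section Smooth.
Variables (K : numFieldType) (V : vectType K) (X : set V).

Let X' : set ('I_(\dim {:V}) -> K) := [set crd p | p in X].

Let vanishing_crd : vanishing_ideal X = mvanish X'.
Proof.
apply/seteqP; split=> f If; first by move=> _ [p Xp <-]; apply: If.
by move=> p Xp; apply: If; exists p.
Qed.

Lemma pdiff_locally_constant (q : polyfun V) p : X p ->
  (forall p v, X p -> tangent_space X p v -> pdiff q p v = 0) ->
  exists u : polyfun V, peval u p <> 0 /\
    forall p', X p' -> peval u p' != 0 -> peval q p' = peval q p.
Proof.
move=> Xp dq.
have [|u [u0 Iu]] :=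
    @locally_constant _ _ X' q (crd p) _ (ex_intro2 _ _ p Xp erefl).
  move=> _ [p' Xp' <-] c Tc; have [v vc] := crd_surj c.
  have E f : mdiff f (crd p') c = pdiff f p' v.
    by apply: eq_bigr => i _; rewrite vc.
  by rewrite E; apply: dq => // f If; rewrite -E; apply: Tc; rewrite -vanishing_crd.
exists u; split; first exact/eqP.
move=> p' Xp' up'; have /eqP := Iu (crd p') (ex_intro2 _ _ p' Xp' erefl).
rewrite mevalM mulf_eq0 (negPf up') /= mevalB mevalC subr_eq0 => /eqP //.
Qed.

(** Pulling back along [L] turns members of the ideal with independent differentials at [p'] into
    such members at [p], independence being kept because [L] is surjective. So the rank at [p] is at
    least that at nearby points. *)
Lemma smooth_at_homogeneous p (u : polyfun V) : X p -> peval u p <> 0 ->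
  (forall p', X p' -> peval u p' != 0 -> exists L : V -> V, exists L' : V -> V,
    [/\ linear L, cancel L' L, L p = p' & forall x, X x -> X (L x)]) ->
  smooth_at X p.
Proof.
move=> Xp up hom.
have [|||r [f [s [If s0 gen freef]]]] := @smooth_of_rank _ _ X' (crd p) u.
- by exists p.
- exact/eqP.
- move=> _ r g [p' Xp' <-] up' Ig freeg.
  have [L [L' [LP L'K Lp LX]]] := hom p' Xp' up'.
  exists (fun i => pullback L (g i)) => [i|].
    by rewrite -vanishing_crd; apply: vanishing_pullback LX _ => //; rewrite vanishing_crd.
  apply/inj_row_free => c c0; apply/eqP; move: freeg; apply: contraTT => cn0.
  apply/negP => /row_free_inj freeg; case/eqP: cn0; apply: freeg.
  rewrite mul0mx; apply/rowP => j; rewrite mxE [RHS]mxE.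
  have [v vj] := crd_surj (fun k => (k == j)%:R).
  have delta (h : polyfun V) : pdiff h p' v = (h^`M(j)).@[crd p'].
    rewrite /pdiff (bigD1 j) //= vj eqxx mul1r big1 ?addr0 // => k /negPf kj.
    by rewrite vj kj mul0r.
  transitivity (\sum_i c 0 i * pdiff (pullback L (g i)) p (L' v)).
    by apply: eq_bigr => i _; rewrite mxE (pdiff_pullback LP) L'K Lp delta.
  transitivity (\sum_k crd (L' v) k * (c *m mjac (fun i => pullback L (g i)) (crd p)) 0 k).
    under eq_bigr do rewrite mulr_sumr.
    rewrite exchange_big; apply: eq_bigr => k _; rewrite mxE mulr_sumr.
    by apply: eq_bigr => i _; rewrite mxE mulrCA.
  by rewrite c0 big1 // => k _; rewrite mxE mulr0.
exists r, f, s; split; rewrite ?vanishing_crd //; exact/eqP.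
Qed.

End Smooth.

(** * Transversality of the Slodowy slice *)

Section ShiftedProducts.
Variables (K : fieldType) (V : vectType K) (h : 'End(V)).
Implicit Types (s t : seq K) (u v : V).

(** The product of the commuting operators h - c, for c in [s], applied to [v]. *)
Definition shifted s v := foldl (fun u c => h u - c *: u) v s.

Lemma shifted_linear s : linear (shifted s).
Proof.
elim: s => [//|c s IHs] a u v /=; rewrite /shifted /= -!/(shifted s _) -IHs.
by congr shifted; rewrite linearP scalerDr scalerBr opprD addrACA !scalerA [a * c]mulrC.
Qed.

HB.instance Definition _ s :=
  GRing.isLinear.Build K V V *:%R (shifted s) (shifted_linear s).

Lemma shifted_comm s c v : shifted s (h v - c *: v) = h (shifted s v) - c *: shifted s v.
Proof.
elim: s v => [//|d s IHs] v /=; rewrite /shifted /= -!/(shifted s _) -IHs.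
congr shifted; rewrite !linearB !linearZ /= !scalerA [c * d]mulrC.
by rewrite addrACA.
Qed.

Lemma shifted_eigen s c v : h v = c *: v -> shifted s v = \prod_(d <- s) (c - d) *: v.
Proof.
move=> hv; elim: s => [|d s IHs]; first by rewrite big_nil scale1r.
rewrite big_cons /shifted /= -/(shifted s _) hv -scalerBl linearZ /= IHs scalerA //.
Qed.

Lemma shifted_stable s v (U : set V) : (forall a u w, U u -> U w -> U (a *: u + w)) ->
  (forall u, U u -> U (h u)) -> U v -> U (shifted s v).
Proof.
move=> Ulin Uh; elim: s v => [//|c s IHs] v Uv; apply: IHs.
by rewrite addrC -scaleNr; apply: Ulin => //; apply: Uh.
Qed.

(** By induction (h - c) v = 0 for the first c in [s], and on such an eigenvector the product over
    [t] is a nonzero scalar. *)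
Lemma shifted_coprime s t v : {in s & t, forall c d, c != d} ->
  shifted s v = 0 -> shifted t v = 0 -> v = 0.
Proof.
elim: s v => [//|c s IHs] v st sv tv.
have hv : h v = c *: v.
  apply/eqP; rewrite -subr_eq0; apply/eqP; apply: IHs => //.
    by move=> a b sa tb; apply: st => //; rewrite inE sa orbT.
  by rewrite shifted_comm tv linear0 scaler0 subrr.
move/eqP: tv; rewrite (shifted_eigen _ hv) scaler_eq0 prodf_seq_eq0.
case/orP => [/hasP[d td /=]|/eqP //].
by rewrite subr_eq0 (negPf (st c d _ td)) // mem_head.
Qed.

(* A vector killed by (h - c_1) ... (h - c_k), the c_i being distinct, is a sum
   of eigenvectors. *)
Lemma shifted_ind (U A : set V) s : uniq s ->
  (forall a u v, U u -> U v -> U (a *: u + v)) -> (forall u, U u -> U (h u)) ->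
  A 0 -> (forall a u v, A u -> A v -> A (a *: u + v)) ->
  (forall c u, c \in s -> U u -> h u = c *: u -> A u) ->
  forall v, U v -> shifted s v = 0 -> A v.
Proof.
move=> us Ulin Uh; elim: s us A => [|c s IHs] /= us A A0 Alin Aeig v Uv.
  by rewrite /shifted /= => ->.
case/andP: us => cs us sv; have U0 : U 0.
  by have := Ulin (-1) v v Uv Uv; rewrite scaleN1r addNr.
(* The image of U and A under h - c. An eigenvector of eigenvalue d other than c is the image of its
   multiple by 1 / (d - c). *)
pose A' u := exists v', [/\ U v', A v' & h v' - c *: v' = u].
have [||||v' [Uv' Av' hv']] := IHs us A' _ _ _ (h v - c *: v) _ sv.
- by exists 0; rewrite linear0 scaler0 subrr.
- move=> a _ _ [u [Uu Au <-]] [w [Uw Aw <-]]; exists (a *: u + w).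
  split; [exact: Ulin|exact: Alin|rewrite linearP scalerDr scalerBr opprD addrACA].
  by rewrite !scalerA [a * c]mulrC.
- move=> d u ds Uu hu; have dc : d - c != 0.
    by rewrite subr_eq0; apply: contraNneq cs => <-.
  exists ((d - c)^-1 *: u); split.
  + by rewrite -[X in U X]addr0; apply: Ulin.
  + rewrite -[X in A X]addr0; apply: Alin => //.
    by apply: Aeig (hu) => //; rewrite inE ds orbT.
  + by rewrite linearZ /= hu !scalerA -scalerBl [c * _]mulrC -mulrBr mulVf // scale1r.
- by rewrite addrC -scaleNr; apply: Ulin => //; apply: Uh.
(* [v - v'] is an eigenvector for c, and [v'] is in A. *)
rewrite -[v](subrK v') -[v - v']scale1r; apply: Alin => //.
apply: (Aeig c); rewrite ?mem_head //.
  by rewrite addrC -scaleN1r; apply: Ulin.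
rewrite linearB scalerBr /= -[h v](subrK (c *: v)) -hv' addrAC [h v' - _]addrC.
by rewrite addrK addrC.
Qed.

(* From a^N = 0 downwards: b a^(k+1) u = 0 gives a^k (h - d_k) u = 0. *)
Lemma shifted_nilpotent (W : set V) (a b : 'End(V)) (c d : nat -> K) N :
  (forall k u v, W u -> W v -> W (k *: u + v)) -> (forall u, W u -> W (h u)) ->
  (forall v, iter N a v = 0) -> (forall k, c k != 0) ->
  (forall k w, W w -> b (iter k.+1 a w) = c k *: iter k a (h w - d k *: w)) ->
  forall w, W w -> shifted [seq d i | i <- iota 0 N] w = 0.
Proof.
move=> Wlin Wh aN c0 ba.
suff gen j w : (j <= N)%N -> W w ->
    iter (N - j) a (shifted [seq d i | i <- iota (N - j) j] w) = 0.
  by move=> w Ww; have := gen N w (leqnn N) Ww; rewrite subnn.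
elim: j w => [|j IHj] w; first by rewrite subn0 aN.
move=> jN Ww; have Nj : (N - j = (N - j.+1).+1)%N by rewrite subnS prednK // subn_gt0.
rewrite /= /shifted /= -/(shifted _ _) shifted_comm.
have := IHj w (ltnW jN) Ww; rewrite Nj => /(congr1 b); rewrite ba; last first.
  exact: shifted_stable.
by rewrite linear0 => /eqP; rewrite scaler_eq0 (negPf (c0 _)) => /eqP.
Qed.

End ShiftedProducts.

(** A dimension count: the dimensions of [limg a] and [lker b] add up to that of V. *)
Lemma limg_lker_complement (K : fieldType) (V : vectType K) (a b : 'End(V)) :
  \dim (lker a) = \dim (lker b) ->
  (limg a + lker b == fullv)%VS = (limg a :&: lker b == 0)%VS.
Proof.
move=> ab; have := limg_ker_dim a fullv; rewrite capfv ab => dimV.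
have := dimv_sum_cap (limg a) (lker b); rewrite [X in _ = X]addnC dimV => dimS.
rewrite -dimv_eq0 -(dimv_leqif_eq (subvf _)).2 -(eqn_add2r (\dim (limg a :&: lker b))) dimS.
by rewrite addnC -{1}[\dim fullv]add0n eqn_add2r eq_sym.
Qed.

(** * Weights of an sl2-triple *)

Section Slodowy.
Variables (K : numFieldType) (V : vectType K) (br : {linear V -> 'End(V)}).
Hypothesis jacobi : forall a b c, br a (br b c) = br (br a b) c + br b (br a c).
Variables (xi h eta : V) (N : nat).
Hypotheses (brxe : br xi eta = h) (brhx : br h xi = 2 *: xi).
Hypothesis brhe : br h eta = - 2 *: eta.
Hypotheses (nilx : forall v, iter N (br xi) v = 0) (nile : forall v, iter N (br eta) v = 0).

Let brDl a b v : br (a + b) v = br a v + br b v.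
Proof. by rewrite linearD add_lfunE. Qed.

Let brZl k a v : br (k *: a) v = k *: br a v.
Proof. by rewrite linearZ scale_lfunE. Qed.

Let ef v : br xi (br eta v) = br eta (br xi v) + br h v.
Proof. by rewrite jacobi brxe addrC. Qed.

Let he v : br h (br xi v) = br xi (br h v) + 2 *: br xi v.
Proof. by rewrite jacobi brhx brZl addrC. Qed.

Let hf v : br h (br eta v) = br eta (br h v) - 2 *: br eta v.
Proof. by rewrite jacobi brhe brZl addrC scaleNr. Qed.

Let iter_linear k (a : 'End(V)) c u w :
  iter k a (u + c *: w) = iter k a u + c *: iter k a w.
Proof. by elim: k => //= k ->; rewrite linearD linearZ. Qed.

Let iterZ k (a : 'End(V)) c u : iter k a (c *: u) = c *: iter k a u.
Proof. by elim: k => //= k ->; rewrite linearZ. Qed.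

Let h_iter_e k v :
  br h (iter k (br xi) v) = iter k (br xi) (br h v) + (2 * k)%:R *: iter k (br xi) v.
Proof.
elim: k => [|k IHk] /=; first by rewrite muln0 scale0r addr0.
by rewrite he IHk linearD linearZ /= mulnS natrD; vect_ring.
Qed.

Let h_iter_f k v :
  br h (iter k (br eta) v) = iter k (br eta) (br h v) - (2 * k)%:R *: iter k (br eta) v.
Proof.
elim: k => [|k IHk] /=; first by rewrite muln0 scale0r subr0.
by rewrite hf IHk linearB linearZ /= mulnS natrD; vect_ring.
Qed.

(** The usual commutation formula on vectors killed by eta. The double sign gives it the shape
    expected by [shifted_nilpotent], with roots - k. *)
Let f_iter_e k v : br eta v = 0 ->
  br eta (iter k.+1 (br xi) v) = - k.+1%:R *: iter k (br xi) (br h v - - k%:R *: v).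
Proof.
move=> fv; rewrite (scaleNr k%:R) opprK iter_linear; elim: k => [|k IHk].
  have := ef v; rewrite fv linear0 => /eqP; rewrite eq_sym addr_eq0 => /eqP /= ->.
  by vect_ring.
have -> : br eta (iter k.+2 (br xi) v) =
    br xi (br eta (iter k.+1 (br xi) v)) - br h (iter k.+1 (br xi) v).
  by rewrite [in RHS]ef addrK.
rewrite IHk h_iter_e linearZ linearD linearZ /= mulnS natrD -!natr1 natrM.
by vect_ring.
Qed.

Let e_iter_f k v : br eta (br xi v) = 0 ->
  br xi (iter k.+1 (br eta) v) = k.+1%:R *: iter k (br eta) (br h v - k%:R *: v).
Proof.
move=> fv; rewrite -scaleNr iter_linear; elim: k => [|k IHk].
  by rewrite /= ef fv; vect_ring.
rewrite [iter k.+2 _ _]iterS ef IHk h_iter_f linearZ linearD linearZ /=.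
rewrite mulnS natrD -!natr1 natrM.
by vect_ring.
Qed.

Let lowest_weights : seq K := [seq - i%:R | i <- iota 0 N].

Let lowest_shifted v : br eta v = 0 -> shifted (br h) lowest_weights v = 0.
Proof.
apply: (shifted_nilpotent (a := br xi) (b := br eta) (c := fun k => - k.+1%:R)
  (W := [set v | br eta v = 0])) => //.
- by move=> k u w /= u0 w0; rewrite linearP /= u0 w0 scaler0 addr0.
- by move=> u /= u0; have := hf u; rewrite u0 linear0 scaler0 subr0 => <-.
- by move=> k; rewrite oppr_eq0 pnatr_eq0.
Qed.

(** Let v = [xi, u] with [eta, v] = 0. Then v is killed by the product of the h + i for i < N. Also
    u is killed by the product of the h - i, so v is killed by that of the h - i - 2. The two
    products share no root. *)
Lemma limg_xi_lker_eta : (limg (br xi) :&: lker (br eta) = 0)%VS.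
Proof.
apply/eqP; rewrite -subv0; apply/subvP => v /memv_capP[/memv_imgP[u _ ->]].
rewrite memv_ker memv0 => /eqP fe0.
have uQ : shifted (br h) [seq i%:R | i <- iota 0 N] u = 0.
  apply: (shifted_nilpotent (a := br eta) (b := br xi) (c := fun k => k.+1%:R)
    (W := [set v | br eta (br xi v) = 0])) => //.
  - by move=> k x y /= x0 y0; rewrite !linearP /= x0 y0 scaler0 addr0.
  - move=> x /= x0; have := hf (br xi x); rewrite he linearD linearZ /= x0.
    by rewrite linear0 !scaler0 subr0 addr0 => <-.
  - by move=> k; rewrite pnatr_eq0.
apply/eqP/(shifted_coprime (h := br h) (s := [seq i%:R + 2 | i <- iota 0 N]) _ _
  (lowest_shifted fe0)).
  move=> _ _ /mapP[i _ ->] /mapP[j _ ->]; rewrite -subr_eq0 opprK -!natrD.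
  by rewrite pnatr_eq0 addn2.
rewrite -[RHS](linear0 (br xi)) -uQ; elim: (iota 0 N) u {fe0 uQ} => [//|i s IHs] u.
rewrite /shifted /= -!/(shifted _ _ _) -IHs; congr shifted.
by rewrite he [br xi (_ - _)]linearB /= [br xi (i%:R *: u)]linearZ /=; vect_ring.
Qed.

Hypothesis regular_xi_eta : \dim (lker (br xi)) = \dim (lker (br eta)).

Let limg_xiD v : exists y z, br eta z = 0 /\ v = br xi y + z.
Proof.
have /eqP E : (limg (br xi) + lker (br eta) == fullv)%VS.
  by rewrite limg_lker_complement // limg_xi_lker_eta.
have : v \in (limg (br xi) + lker (br eta))%VS by rewrite E memvf.
case/memv_addP=> _ /memv_imgP[y _ ->] [z + ->].
by rewrite memv_ker => /eqP z0; exists y, z.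
Qed.

Let submod (A : set V) := A 0 /\ forall a u w, A u -> A w -> A (a *: u + w).

Let lowest_uniq : uniq lowest_weights.
Proof.
rewrite map_inj_uniq ?iota_uniq // => i j /oppr_inj /eqP.
by rewrite eqr_nat => /eqP.
Qed.

Let lowest_ind (A : set V) : submod A ->
  (forall i v, (i < N)%N -> br eta v = 0 -> br h v = - i%:R *: v -> A v) ->
  forall v, br eta v = 0 -> A v.
Proof.
move=> [A0 Alin] Aeig v v0.
apply: (shifted_ind (h := br h) (U := [set v | br eta v = 0]) lowest_uniq) => //.
- by move=> k u w /= u0 w0; rewrite linearP /= u0 w0 scaler0 addr0.
- by move=> u /= u0; have := hf u; rewrite u0 linear0 scaler0 subr0 => <-.
- move=> _ u /mapP[i + ->] u0 hu; rewrite mem_iota => /andP[_ iN].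
  exact: Aeig hu.
exact: lowest_shifted.
Qed.

Let weight (k : int) v := br h v = k%:~R *: v.

(** Here 2j - i is the weight of xi^j v for v of weight - i killed by eta. *)
Let weights : seq int := [seq (2 * j)%:Z - i%:Z | j <- iota 0 N, i <- iota 0 N].

(* V is spanned by the vectors xi^j v with v a weight vector killed by eta. *)
Let weight_ind (A : set V) : submod A ->
  (forall k v, k \in weights -> weight k v ->
     br eta v = 0 \/ (exists2 y, weight (k - 2) y & v = br xi y) -> A v) ->
  forall v, A v.
Proof.
move=> [A0 Alin] Aeig.
have iter0 j : iter j (br xi) 0 = 0 by elim: j => //= j ->; rewrite linear0.
have iterD j u w : iter j (br xi) (u + w) = iter j (br xi) u + iter j (br xi) w.
  by rewrite -[w]scale1r iter_linear !scale1r.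
have Ae j z : (j < N)%N -> br eta z = 0 -> A (iter j (br xi) z).
  move=> jN; apply: (lowest_ind (A := [set z | A (iter j (br xi) z)])).
    split=> [|a u w Au Aw] /=; first by rewrite iter0.
    by rewrite iterD iterZ; apply: Alin.
  move=> i v iN v0 hv.
  have wt k : weight ((2 * k)%:Z - i%:Z) (iter k (br xi) v).
    rewrite /weight h_iter_e hv iterZ -scalerDl rmorphB /= -!pmulrn.
    by rewrite addrC.
  apply: (Aeig ((2 * j)%:Z - i%:Z)) => //.
    by apply/allpairsP; exists (j, i); rewrite !mem_iota.
  case: j jN wt => [|j] jN wt; [by left|right; exists (iter j (br xi) v) => //].
  by rewrite (_ : _ - _ = (2 * j)%:Z - i%:Z) //; lia.
(* Downward from xi^N = 0: writing v = [xi, y] + z with z killed by eta reduces xi^m v to xi^(m+1) y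
   and xi^m z. *)
suff gen j v : (j <= N)%N -> A (iter (N - j) (br xi) v).
  by move=> v; have := gen N v (leqnn N); rewrite subnn.
elim: j v => [|j IHj] v; first by rewrite subn0 nilx.
move=> jN; have [y [z [z0 ->]]] := limg_xiD v.
rewrite iterD -iterSr -subSn // subSS -[X in A (X + _)]scale1r.
apply: Alin; first exact/IHj/ltnW.
by apply: Ae => //; rewrite ltn_subrL (leq_ltn_trans _ jN).
Qed.

(** The product of the h - c over [weights] is zero on V, but a nonzero scalar on vectors of any
    other weight. *)
Let weights_K k : k \notin weights -> forall v, weight k v -> v = 0.
Proof.
move=> kw v hv; pose t : seq K := [seq c%:~R | c <- weights].
have : shifted (br h) t v = 0.
  apply: (weight_ind (A := [set v | shifted (br h) t v = 0])) => [|c w cw hw _] /=.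
    split=> [|a u w /= u0 w0]; first exact: linear0.
    by rewrite linearP /= u0 w0 scaler0 addr0.
  rewrite (shifted_eigen _ hw) (big_rem c%:~R) ?map_f //= subrr mul0r.
  by rewrite scale0r.
rewrite (shifted_eigen _ hv) => /eqP; rewrite scaler_eq0 => /orP[|/eqP //].
rewrite prodf_seq_eq0 => /hasP[_ /mapP[c cw ->]] /=.
by rewrite subr_eq0 eqr_int => /eqP kc; rewrite kc cw in kw.
Qed.

(** The product of the h - c over the weights c other than k is, up to a nonzero scalar [P], the
    projection to weight k. Applied to the spanning vectors of [weight_ind], it shows that [xi, y] +
    z can be chosen homogeneous. *)
Let weight_split k w : weight k w ->
  exists y z, [/\ weight (k - 2) y, br eta z = 0 & w = br xi y + z].
Proof.
move=> hw; pose t : seq K := [seq c%:~R | c <- weights & c != k].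
pose B v := exists y z,
  [/\ weight (k - 2) y, br eta z = 0 & shifted (br h) t v = br xi y + z].
have B0 v : shifted (br h) t v = 0 -> B v.
  by move=> v0; exists 0, 0; split; rewrite /weight ?v0 ?linear0 ?scaler0 ?addr0.
have subB : submod B.
  split=> [|a u v [y [z [hy z0 yz]]] [y' [z' [hy' z0' yz']]]].
    by apply: B0; rewrite linear0.
  exists (a *: y + y'), (a *: z + z'); split.
  - by rewrite /weight linearP /= hy hy' scalerDr !scalerA mulrC.
  - by rewrite linearP /= z0 z0' scaler0 addr0.
  - by rewrite !linearP /= yz yz' scalerDr addrACA.
have [|y [z [hy z0]]] := weight_ind subB _ w.
  move=> c v cw hv vyz; have [ck|ck] := eqVneq c k; last first.
    apply: B0; rewrite (shifted_eigen _ hv) (big_rem c%:~R) /= ?subrr ?mul0r ?scale0r //.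
    by apply: map_f; rewrite mem_filter ck.
  rewrite /B (shifted_eigen _ hv); set P := \prod_(_ <- _) _.
  case: vyz => [v0|[y hy ->]].
    by exists 0, (P *: v); rewrite /weight !linear0 add0r linearZ /= v0 scaler0.
  exists (P *: y), 0; rewrite linear0 addr0 linearZ; split=> //.
  by rewrite /weight linearZ /= hy -ck !scalerA mulrC.
rewrite (shifted_eigen _ hw); set P := \prod_(_ <- _) _ => Pw.
have P0 : P != 0.
  rewrite prodf_seq_neq0; apply/allP => _ /mapP[c + ->] /=.
  by rewrite mem_filter subr_eq0 eqr_int eq_sym => /andP[].
exists (P^-1 *: y), (P^-1 *: z); split.
- by rewrite /weight linearZ /= hy !scalerA mulrC.
- by rewrite linearZ /= z0 scaler0.
- by rewrite linearZ -scalerDr -Pw scalerA mulVf // scale1r.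
Qed.

Section Translate.
Variables (z0 : V) (etaz0 : br eta z0 = 0).
Let s := xi + z0.

Let img v := exists y z, br eta z = 0 /\ v = br s y + z.

Let submod_img : submod img.
Proof.
split=> [|a u w [y [z [fz ->]]] [y' [z' [fz' ->]]]].
  by exists 0, 0; rewrite !linear0 addr0.
exists (a *: y + y'), (a *: z + z'); split.
  by rewrite linearP /= fz fz' scaler0 addr0.
by rewrite linearP /= scalerDr addrACA.
Qed.

(* s differs from xi by a vector of nonpositive weights, so that v - [s, y] has
   smaller weights than v when v = [xi, y] + z is the splitting of v. *)
Let slice_transversal v : img v.
Proof.
have [img0 imgP] := submod_img.
apply: (weight_ind submod_img) => k {}v _ hv _.
(* Induction on a bound for k + N; at M = 0 the weight k is below - N, where V has no weight
   vectors. *)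
have [M] : exists M : nat, (k < M%:Z - N%:Z).
  by exists (absz (k + N%:Z + 1)); lia.
elim: M k v hv => [|M IHM] k v hv kM.
  rewrite (weights_K _ hv) //; apply/negP => /allpairsP[[j i] /= [_ + kij]].
  by rewrite mem_iota => /andP[_ iN]; lia.
have [y [z [hy fz ->]]] := weight_split hv.
have -> : br xi y + z = (-1) *: br z0 y + (br s y + z).
  by rewrite /s brDl; vect_ring.
apply: (imgP); last by exists y, z.
(* [z0] is a sum of vectors of weight - i, and bracketing one of them with [y] gives weight k - 2 -
   i. *)
apply: (lowest_ind (A := [set a | img (br a y)]) _ _ etaz0).
  split=> [|a u w Au Aw] /=; first by rewrite linear0 lfunE.
  by rewrite brDl brZl; apply: imgP.
move=> i a iN _ ha; apply: (IHM (k - 2 - i%:Z)); last by lia.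
rewrite /weight jacobi ha brZl hy linearZ /= -scalerDl.
by rewrite [in RHS]rmorphB /= -pmulrn addrC.
Qed.

Lemma slodowy_slice_transversal : \dim (lker (br s)) = \dim (lker (br eta)) ->
  (limg (br s) :&: lker (br eta) = 0)%VS.
Proof.
move=> dims; apply/eqP; rewrite -limg_lker_complement //.
rewrite eqEsubv subvf /=; apply/subvP => v _.
have [y [z [fz ->]]] := slice_transversal v.
by apply: memv_add; rewrite ?memv_img ?memvf // memv_ker fz.
Qed.

End Translate.

End Slodowy.

(** * The Lie algebra of a linear group *)

Section LieAlgebra.
Variables (K : numFieldType) (n : nat) (G : set 'M[K]_n) (subG : subgroup G).
Local Notation L := (lie_alg G).
Implicit Types (g a b y w : 'M[K]_n).

Let unitG g : G g -> g \in unitmx. Proof. by case: subG => + _ _ _; apply. Qed.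
Let GM a b : G a -> G b -> G (a *m b). Proof. by case: subG => _ _ + _; apply. Qed.
Let GV a : G a -> G (invmx a). Proof. by case: subG => _ _ _; apply. Qed.

Lemma mulmxl_linear g : linear (fun a : 'M[K]_n => g *m a).
Proof. exact: linearP. Qed.

Lemma mulmxr_linear g : linear (fun a : 'M[K]_n => a *m g).
Proof. by move=> c a b; rewrite mulmxDl scalemxAl. Qed.

Lemma Ad_linear g : linear (Ad g).
Proof. by move=> c a b; rewrite /Ad mulmxl_linear mulmxr_linear. Qed.

Lemma AdK g : g \in unitmx -> cancel (Ad g) (Ad (invmx g)).
Proof. by move=> ug y; rewrite /Ad invmxK !mulmxA mulVmx // mul1mx mulmxKV. Qed.

Lemma lie_Ad g a b : g \in unitmx -> lie (Ad g a) (Ad g b) = Ad g (lie a b).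
Proof.
move=> ug; have mulAd c d : Ad g c *m Ad g d = Ad g (c *m d).
  by rewrite /Ad !mulmxA mulmxKV.
by rewrite /lie !mulAd /Ad mulmxBr mulmxBl.
Qed.

Lemma jacobi_lie a b c : lie a (lie b c) = lie (lie a b) c + lie b (lie a c).
Proof.
rewrite /lie !(mulmxBr, mulmxBl) !mulmxA; apply/matrixP => i j; rewrite !mxE; ring.
Qed.

Lemma lie_alg_Ad g y : G g -> y \in L -> Ad g y \in L.
Proof.
move=> Gg /mem_lie_alg Ty; apply/mem_lie_alg.
have := tangent_space_image (L := Ad g) (Ad_linear g) (Y := G) _ Ty.
have -> : Ad g 1%:M = 1%:M by rewrite /Ad mulmx1 mulmxV ?unitG.
apply => a Ga.
by apply: GM; [apply: GM|apply: GV].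
Qed.

Lemma tangent_space_lie g v : G g -> tangent_space G g v -> v *m invmx g \in L.
Proof.
move=> Gg Tv; apply/mem_lie_alg.
have := tangent_space_image (mulmxr_linear (invmx g)) (Y := G) _ Tv.
rewrite mulmxV ?unitG //; apply => a Ga.
by apply: GM => //; apply: GV.
Qed.

Lemma tangent_space_mul g y : G g -> y \in L -> tangent_space G g (g *m y).
Proof.
move=> Gg /mem_lie_alg Ty.
have := tangent_space_image (mulmxl_linear g) (Y := G) _ Ty.
by rewrite mulmx1; apply => a; apply: GM.
Qed.

(* The value at a of the derivative of f along the left-invariant field y. *)
Let field y (f : {mpoly K[\dim {: 'M[K]_n}]}) : {mpoly K[\dim {: 'M[K]_n}]} :=
  \sum_i plin (fun a : 'M[K]_n => crd (a *m y) i) * f^`M(i).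

Let fieldL y i : linear_for *%R (fun a : 'M[K]_n => crd (a *m y) i).
Proof. by move=> c a b; rewrite mulmxr_linear crd_linear. Qed.

Let vanishing_field y f : y \in L -> vanishing_ideal G f -> vanishing_ideal G (field y f).
Proof.
move=> Ly If a Ga; rewrite peval_sum -[RHS](tangent_space_mul Ga Ly If).
by apply: eq_bigr => i _; rewrite pevalM (peval_plin (fieldL y i)).
Qed.

(** Product rule: the double sum is the Hessian of f at 1, evaluated on y and w. *)
Let pdiff_field y w f : pdiff (field y f) 1%:M w =
  pdiff f 1%:M (w *m y) + \sum_i \sum_j crd y i * crd w j * peval f^`M(i)^`M(j) 1%:M.
Proof.
rewrite pdiff_sum -big_split; apply: eq_bigr => i _ /=.
rewrite pdiffM (pdiff_plin (fieldL y i)) (peval_plin (fieldL y i)) mul1mx.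
congr (_ + _); rewrite /pdiff mulr_sumr; apply: eq_bigr => j _.
by rewrite mulrA.
Qed.

(** Both iterated derivatives of f, along y then w and along w then y, vanish at 1. Their Hessian
    terms cancel by symmetry, leaving the differential of f at y w - w y. *)
Lemma lie_alg_lie y w : y \in L -> w \in L -> lie y w \in L.
Proof.
move=> Ly Lw; apply/mem_lie_alg => f If.
have Tw := (mem_lie_alg G w).1 Lw; have Ty := (mem_lie_alg G y).1 Ly.
pose S a b := \sum_i \sum_j crd a i * crd b j * peval f^`M(i)^`M(j) 1%:M.
have symS : S w y = S y w.
  rewrite /S exchange_big; apply: eq_bigr => i _; apply: eq_bigr => j _ /=.
  by rewrite mderiv_comm [crd w j * _]mulrC.
have := Ty _ (vanishing_field Lw If); have := Tw _ (vanishing_field Ly If).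
rewrite !pdiff_field -!/(S _ _) symS => wy yw.
rewrite /lie addrC -scaleN1r (pdiff_linear f) mulN1r addrC.
by rewrite -(subrr 0) -{1}yw -wy opprD addrACA subrr addr0.
Qed.

Section Killing.

Lemma trace_comm (f g : {linear 'M[K]_n -> 'M[K]_n}) :
  (forall v, v \in L -> f v \in L) -> (forall v, v \in L -> g v \in L) ->
  \sum_(i < \dim L) coord (vbasis L) i (f (g (vbasis L)`_i)) =
  \sum_(i < \dim L) coord (vbasis L) i (g (f (vbasis L)`_i)).
Proof.
have gen (f' g' : {linear 'M[K]_n -> 'M[K]_n}) : (forall v, v \in L -> g' v \in L) ->
    \sum_(i < \dim L) coord (vbasis L) i (f' (g' (vbasis L)`_i)) =
    \sum_(i < \dim L) \sum_(j < \dim L)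
      coord (vbasis L) j (g' (vbasis L)`_i) * coord (vbasis L) i (f' (vbasis L)`_j).
  move=> g'L; apply: eq_bigr => i _.
  rewrite {1}(coord_vbasis (g'L _ (vbasis_mem (mem_nth _ _)))) ?size_tuple //.
  rewrite !linear_sum; apply: eq_bigr => j _; by rewrite !linearZ.
move=> fL gL; rewrite !gen // exchange_big; apply: eq_bigr => i _.
by apply: eq_bigr => j _; rewrite mulrC.
Qed.

(** As ad s and ad y commute, ad s ad [y, w] is the commutator of ad y and ad s ad w, which has
    trace zero. *)
Lemma killing_commuting s y w : s \in L -> y \in L -> w \in L -> lie s y = 0 ->
  killing L s (lie y w) = 0.
Proof.
move=> Ls Ly Lw sy; have LL a v : a \in L -> v \in L -> lie a v \in L.
  exact: lie_alg_lie.
pose sw : {linear 'M[K]_n -> 'M[K]_n} := lie s \o lie w.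
have := @trace_comm (lie y) sw (fun v => LL y v Ly) _.
rewrite /killing /sw /= => /(_ (fun v Lv => LL s _ Ls (LL w v Lw Lv))) trE.
transitivity (\sum_(i < \dim L) (coord (vbasis L) i (lie y (lie s (lie w (vbasis L)`_i)))
    - coord (vbasis L) i (lie s (lie w (lie y (vbasis L)`_i))))).
  apply: eq_bigr => i _; rewrite -linearB /=; congr (coord _ _ _).
  rewrite -[lie (lie y w) _](addrK (lie w (lie y (vbasis L)`_i))) -jacobi_lie.
  by rewrite linearB /= [lie s (lie y _)]jacobi_lie sy /lie mul0mx mulmx0 subr0 add0r.
by rewrite sumrB trE subrr.
Qed.

Lemma killing_r0 s : killing L s 0 = 0.
Proof.
rewrite /killing big1 // => i _.
by rewrite /(lie 0) mul0mx mulmx0 subr0 !linear0.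
Qed.

End Killing.

(** [Ad g] embeds one centralizer in the other, and its inverse does the converse. *)
Lemma dim_centralizer_Ad g x : G g -> x \in L ->
  \dim (centralizer L (Ad g x)) = \dim (centralizer L x).
Proof.
suff le g' x' : G g' -> (\dim (centralizer L x') <= \dim (centralizer L (Ad g' x')))%N.
  move=> Gg Lx; apply/eqP; rewrite eqn_leq le // andbT.
  by rewrite -{2}[x](AdK (unitG Gg)) le //; apply: GV.
move=> Gg; pose A : {linear 'M[K]_n -> 'M[K]_n} := HB.pack (Ad g')
  (GRing.isLinear.Build K 'M[K]_n 'M[K]_n *:%R (Ad g') (Ad_linear g')).
rewrite -(@limg_dim_eq _ _ _ (linfun A)).
  apply: dimvS; apply/subvP => _ /memv_imgP[y + ->].
  rewrite lfunE /= !mem_centralizer => /andP[Ly /eqP xy].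
  by rewrite lie_alg_Ad // lie_Ad ?unitG // xy /Ad mulmx0 mul0mx eqxx.
apply/eqP; rewrite -subv0; apply/subvP => y /memv_capP[_].
rewrite memv_ker memv0 lfunE /= => /eqP y0.
by rewrite -[y](AdK (unitG Gg)) y0 /Ad mulmx0 mul0mx.
Qed.

Lemma centralizer_opp x : centralizer L (- x) = centralizer L x.
Proof.
apply/vspaceP => y; rewrite !mem_centralizer.
by rewrite /lie mulNmx mulmxN -opprD oppr_eq0.
Qed.

(** * Regular elements of the Slodowy slice *)

Section Transversality.
Variables (xi h eta : 'M[K]_n) (triple : regular_sl2_triple G xi h eta).

(** The bracket is carried to the vector space type [subvs_of L], where the theory of sl2-triples
    above applies. *)
Let bracket (u v : subvs_of L) : subvs_of L := vsproj L (lie (vsval u) (vsval v)).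

Let vsval_bracket u v : vsval (bracket u v) = lie (vsval u) (vsval v).
Proof. by rewrite /bracket vsprojK // lie_alg_lie // subvsP. Qed.

Let bracket_linear u : linear (bracket u).
Proof. by move=> k v w; rewrite /bracket !linearP. Qed.

Let br (u : subvs_of L) : 'End(subvs_of L) :=
  linfun (HB.pack (bracket u) (GRing.isLinear.Build K _ _ *:%R _ (bracket_linear u))
    : {linear subvs_of L -> subvs_of L}).

Let brE u v : br u v = bracket u v.
Proof. by rewrite lfunE. Qed.

Let br_linear : linear br.
Proof.
move=> k u v; apply/lfunP => w; rewrite add_lfunE scale_lfunE !brE.
apply: subvs_inj; rewrite linearP /= !vsval_bracket linearP.
by rewrite /lie mulmxDl mulmxDr -scalemxAl -scalemxAr scalerBr opprD addrACA.
Qed.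

Let brL : {linear subvs_of L -> 'End(subvs_of L)} :=
  HB.pack br (GRing.isLinear.Build K _ _ *:%R br br_linear).

Let vsval_br u v : vsval (brL u v) = lie (vsval u) (vsval v).
Proof. by rewrite brE vsval_bracket. Qed.

Let dim_lker_br x (Lx : x \in L) : \dim (lker (brL (Subvs Lx))) = \dim (centralizer L x).
Proof.
pose iota := linfun (vsval : subvs_of L -> 'M[K]_n).
have iotaE u : iota u = vsval u by rewrite lfunE.
rewrite -(@limg_dim_eq _ _ _ iota).
  congr (\dim _); apply/vspaceP => y; rewrite mem_centralizer.
  apply/memv_imgP/andP => [[u + ->]|[Ly /eqP xy]].
    rewrite iotaE memv_ker subvsP => /eqP u0.
    by rewrite -[x]/(vsval (Subvs Lx)) -vsval_br u0 linear0.
  exists (Subvs Ly); rewrite ?iotaE // memv_ker; apply/eqP/subvs_inj.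
  by rewrite vsval_br linear0.
apply/eqP; rewrite -subv0; apply/subvP => u /memv_capP[_].
by rewrite memv_ker memv0 iotaE => /eqP u0; apply/eqP/subvs_inj; rewrite u0 linear0.
Qed.

(** Any larger exponent is allowed, so that xi and eta can share one. *)
Let nilpotent_br x (Lx : x \in L) k : (forall y, y \in L -> iter k (lie x) y = 0) ->
  forall m v, (k <= m)%N -> iter m (brL (Subvs Lx)) v = 0.
Proof.
move=> xk m v km; apply: subvs_inj; rewrite linear0.
have iterE j : vsval (iter j (brL (Subvs Lx)) v) = iter j (lie x) (vsval v).
  by elim: j => //= j IHj; rewrite vsval_br IHj.
rewrite iterE -(subnK km) iterD xk ?subvsP //.
by elim: (m - k)%N => //= j ->; rewrite linear0.
Qed.

Let regular_nilpotent x : regular_nilpotent_orbit G x ->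
  [/\ x \in L, \dim (centralizer L x) = rk G
    & exists k, forall y, y \in L -> iter k (lie x) y = 0].
Proof.
move=> [x0 [[Lx0 [k x0k]] reg [g Gg gx]]].
have [Lx rx] : regular_elements G x by apply: reg; exists g.
split=> //; exists k => y Ly; have ug := unitG Gg.
have iterE j w : iter j (lie x) (Ad g w) = Ad g (iter j (lie x0) w).
  by elim: j => //= j ->; rewrite -gx lie_Ad.
rewrite -[y](AdK (_ : invmx g \in unitmx)) ?unitmx_inv // invmxK iterE x0k.
  by rewrite /Ad mulmx0 mul0mx.
by apply: lie_alg_Ad => //; apply: GV.
Qed.

(** [s, y] is in the image of ad s and in the kernel of ad eta; for regular s in the slice these
    meet only in 0. *)
Lemma slodowy_slice_centralizer s y : slodowy_slice G xi eta s ->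
  \dim (centralizer L s) = rk G -> y \in L -> lie s y \in centralizer L eta ->
  lie s y = 0.
Proof.
case: triple => -[/regular_nilpotent[Lxi rxi [k1 nxi]]].
move=> /regular_nilpotent[Leta reta [k2 neta]] Lh xe hx he.
move=> [z /= + <-]; rewrite mem_centralizer => /andP[Lz /eqP ez] rs Ly.
rewrite mem_centralizer => /andP[Ls /eqP es].
pose Xi := Subvs Lxi; pose H := Subvs Lh; pose Eta := Subvs Leta.
have Ljac (a b c : subvs_of L) : brL a (brL b c) = brL (brL a b) c + brL b (brL a c).
  by apply: subvs_inj; rewrite linearD /= !vsval_br jacobi_lie.
have brxe : brL Xi Eta = H by apply: subvs_inj; rewrite vsval_br.
have brhx : brL H Xi = 2 *: Xi by apply: subvs_inj; rewrite vsval_br linearZ.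
have brhe : brL H Eta = - 2 *: Eta by apply: subvs_inj; rewrite vsval_br linearZ.
have nx v : iter (maxn k1 k2) (brL Xi) v = 0.
  by apply: (nilpotent_br _ nxi); rewrite leq_maxl.
have ne v : iter (maxn k1 k2) (brL Eta) v = 0.
  by apply: (nilpotent_br _ neta); rewrite leq_maxr.
have dims : \dim (lker (brL Xi)) = \dim (lker (brL Eta)) by rewrite !dim_lker_br rxi reta.
have := slodowy_slice_transversal Ljac brxe brhx brhe nx ne dims (z0 := Subvs Lz).
have -> : Xi + Subvs Lz = Subvs (memvD Lxi Lz) by apply: subvs_inj.
rewrite !dim_lker_br rs reta => trans.
have /trans /(_ erefl) : brL Eta (Subvs Lz) = 0.
  by apply: subvs_inj; rewrite vsval_br linear0.
move=> /vspaceP /(_ (brL (Subvs (memvD Lxi Lz)) (Subvs Ly))).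
rewrite memv_cap memv_img ?memvf // memv_ker memv0.
have -> : brL Eta (brL (Subvs (memvD Lxi Lz)) (Subvs Ly)) == 0.
  by apply/eqP/subvs_inj; rewrite !vsval_br linear0.
by move=> /esym/eqP/(congr1 vsval); rewrite vsval_br linear0.
Qed.

End Transversality.
End LieAlgebra.

(** * The fibers of Phi *)

Section Fiber.
Variables (K : numFieldType) (n : nat) (G : set 'M[K]_n) (subG : subgroup G).
Variables (xi h eta : 'M[K]_n) (triple : regular_sl2_triple G xi h eta).
Variables (x : 'M[K]_n) (xreg : regular_elements G x).
Local Notation M := 'M[K]_n.
Local Notation V := (M * M)%type.
Local Notation L := (lie_alg G).
Local Notation S := (slodowy_slice G xi eta).
Local Notation X := (Phi_fiber G S x).
Local Notation Z := (centralizer L eta).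

Let unitG g : G g -> g \in unitmx. Proof. by case: subG => + _ _ _; apply. Qed.

(** Clearing the inverse of g makes the equation of the fiber polynomial in (g, s). *)
Let PhiE g s : g \in unitmx -> Phi (g, s) = x <-> s *m g + g *m x = 0.
Proof.
move=> ug; rewrite /Phi /Ad /= invmxK; split=> [<-|/eqP].
  by rewrite mulmxN !mulmxA mulmxV // mul1mx subrr.
by rewrite addr_eq0 => /eqP E; rewrite -mulmxA E mulmxN opprK mulKmx.
Qed.

Let fiberE (p : V) : X p <-> [/\ G p.1, S p.2 & p.2 *m p.1 + p.1 *m x = 0].
Proof.
case: p => g s; split=> [[[/= Gg Ss] /PhiE-/(_ (unitG Gg))]|[/= Gg Ss E]] //.
by split=> //; apply/PhiE => //; apply: unitG.
Qed.

Let entry1 i j : linear_for *%R (fun p : V => p.1 i j).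
Proof. by move=> c a b; rewrite !mxE. Qed.

Let entry2 i j : linear_for *%R (fun p : V => p.2 i j).
Proof. by move=> c a b; rewrite !mxE. Qed.

Let entryx i j : linear_for *%R (fun p : V => (p.1 *m x) i j).
Proof. by move=> c a b; rewrite mulmxDl -scalemxAl !mxE. Qed.

Let fiber_eq i j : {mpoly K[\dim {: V}]} :=
  \sum_k plin (fun p : V => p.2 i k) * plin (fun p : V => p.1 k j) +
  plin (fun p : V => (p.1 *m x) i j).

Let peval_fiber_eq i j (p : V) : peval (fiber_eq i j) p = (p.2 *m p.1 + p.1 *m x) i j.
Proof.
rewrite pevalD peval_sum (peval_plin (entryx i j)) [RHS]mxE [X in _ = X + _]mxE.
congr (_ + _); apply: eq_bigr => k _.
by rewrite pevalM (peval_plin (entry2 i k)) (peval_plin (entry1 k j)).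
Qed.

Let pdiff_fiber_eq i j (p v : V) :
  pdiff (fiber_eq i j) p v = (v.2 *m p.1 + p.2 *m v.1 + v.1 *m x) i j.
Proof.
rewrite pdiffD pdiff_sum (pdiff_plin (entryx i j)) [RHS]mxE [X in _ = X + _]mxE.
rewrite ![X in _ = X + _ + _]mxE [X in _ = _ + X + _]mxE.
congr (_ + _); rewrite -big_split; apply: eq_bigr => k _ /=.
rewrite pdiffM (pdiff_plin (entry2 i k)) (pdiff_plin (entry1 k j)).
by rewrite (peval_plin (entry2 i k)) (peval_plin (entry1 k j)).
Qed.

Lemma closed_Phi_fiber : zariski_closed_in (G `*` S) X.
Proof.
exists [set f | exists i j, f = fiber_eq i j]; apply/seteqP; split=> p.
  move=> Xp; split; first by case: Xp.
  have [_ _ E] := (fiberE p).1 Xp; move=> _ [i [j ->]].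
  by rewrite peval_fiber_eq E mxE.
move=> [[Gp Sp] E]; apply/fiberE; split=> //; apply/matrixP => i j.
by rewrite -peval_fiber_eq [RHS]mxE; apply: E; exists i, j.
Qed.

Let fst_linear : linear (fun p : V => p.1). Proof. by []. Qed.

Let tangent_lie p v : X p -> tangent_space X p v -> v.1 *m invmx p.1 \in L.
Proof.
case/fiberE => Gp _ _ Tv; apply: tangent_space_lie => //.
have := tangent_space_image fst_linear (Y := G) _ Tv; apply => q.
by case/fiberE.
Qed.

(** Its coordinates are linear forms constant on the slice, so they vanish on tangent vectors; this
    confines the second component to [Z]. *)
Let residue (p : V) : M := p.2 - projv Z p.2.

Let residue_linear i : linear_for *%R (fun p : V => crd (residue p) i).
Proof. by move=> c a b; rewrite /residue /= linearP opprD addrACA -scalerBr crd_linear. Qed.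

Let sliceP s : S s -> s - projv Z s = xi - projv Z xi.
Proof.
by move=> [z /= Zz <-]; rewrite linearD /= [projv Z z]projv_id // opprD addrACA subrr addr0.
Qed.

Let tangent_slice p v : tangent_space X p v -> v.2 \in Z.
Proof.
move=> Tv; rewrite -[v.2](subrK (projv Z v.2)) memvD ?memv_proj //.
suff -> : v.2 - projv Z v.2 = 0 by apply: mem0v.
apply: crd_inj => i; rewrite crd0 -[LHS]/(crd (residue v) i).
rewrite -(pdiff_plin (residue_linear i) p v).
have := Tv (plin (fun p : V => crd (residue p) i) - (crd (xi - projv Z xi) i)%:MP).
rewrite pdiffB pdiffC subr0; apply => p' Xp'.
have [_ Sp' _] := (fiberE p').1 Xp'.
rewrite /peval mevalB mevalC -[X in X - _]/(peval _ p').
by rewrite (peval_plin (residue_linear i)) /residue sliceP // subrr.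
Qed.

(** On the fiber s = - Ad_g x, so s is regular along with x. *)
Let dim_centralizer_slice p : X p -> \dim (centralizer L p.2) = rk G.
Proof.
case/fiberE => Gp _ /eqP; rewrite addr_eq0 => /eqP E; case: xreg => Lx <-.
have ug := unitG Gp; rewrite -(dim_centralizer_Ad subG Gp Lx) -centralizer_opp.
congr (\dim (centralizer _ _)).
by rewrite /Ad -[p.1 *m x]opprK -E mulNmx mulmxK.
Qed.

(* With y = v.1 g^-1, differentiating s g + g x = 0 along v gives v.2 = [y, s],
   which vanishes by transversality of the slice. *)
Lemma tangent_space_fiber p v : X p -> tangent_space X p v ->
  v.2 = 0 /\ lie p.2 (v.1 *m invmx p.1) = 0.
Proof.
move=> Xp Tv; have [Gp Sp Ep] := (fiberE p).1 Xp; have ug := unitG Gp.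
have Ly := tangent_lie Xp Tv.
have Zv := tangent_slice Tv.
have E : v.2 *m p.1 + p.2 *m v.1 + v.1 *m x = 0.
  apply/matrixP => i j; rewrite -pdiff_fiber_eq [RHS]mxE; apply: Tv => q Xq.
  by have [_ _ Eq] := (fiberE q).1 Xq; rewrite peval_fiber_eq Eq mxE.
(* Substitute x = - g^-1 s g in the differentiated equation and multiply by g^-1 on the right. *)
have zE : v.2 = - lie p.2 (v.1 *m invmx p.1).
  move: Ep => /eqP; rewrite addr_eq0 => /eqP Ep.
  have xE : x = - (invmx p.1 *m p.2 *m p.1) by rewrite -mulmxA Ep mulmxN opprK mulKmx.
  apply/eqP; rewrite -addr_eq0 -[X in _ == X](mul0mx _ (invmx p.1)) -E.
  rewrite !mulmxDl mulmxK // xE mulmxN mulNmx /lie !mulmxA mulmxK //.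
  by rewrite addrA.
have lie0 : lie p.2 (v.1 *m invmx p.1) = 0.
  apply: (slodowy_slice_centralizer subG triple Sp) => //.
    exact: dim_centralizer_slice.
  by rewrite -[lie _ _]opprK -zE memvN.
by rewrite zE lie0 oppr0.
Qed.

Let crd2_linear i : linear_for *%R (fun p : V => crd p.2 i).
Proof. by move=> c a b; rewrite crd_linear. Qed.

(** Near p = (g, s) the second component is constant. For p' = (g', s), right multiplication of the
    first component by g^-1 g' is a linear automorphism carrying p to p' and X into itself, so
    [smooth_at_homogeneous] applies. *)
Lemma smooth_Phi_fiber : smooth X.
Proof.
move=> p Xp.
have lc i : exists u : {mpoly K[\dim {: V}]}, peval u p <> 0 /\
    forall p', X p' -> peval u p' != 0 -> crd p'.2 i = crd p.2 i.
  have [q v Xq Tv|u [up uP]] :=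
    pdiff_locally_constant (q := plin (fun p : V => crd p.2 i)) Xp.
    by rewrite (pdiff_plin (crd2_linear i)) (tangent_space_fiber Xq Tv).1 crd0.
  by exists u; split=> // p' Xp' /(uP p' Xp'); rewrite !(peval_plin (crd2_linear i)).
have [u uP] := choice lc.
have pevalP q : peval (\prod_i u i) q = \prod_i peval (u i) q by exact: rmorph_prod.
apply: (@smooth_at_homogeneous _ _ _ _ (\prod_i u i)) => //.
  by apply/eqP; rewrite pevalP; apply/prodf_neq0 => i _; apply/eqP; case: (uP i).
move=> p' Xp'; rewrite pevalP => /prodf_neq0 up'.
have p2 : p'.2 = p.2 by apply: crd_inj => i; apply: (uP i).2 => //; apply: up'.
have [Gp Sp Ep] := (fiberE p).1 Xp; have [Gp' _ Ep'] := (fiberE p').1 Xp'.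
have [_ _ GM GV] := subG; have ug := unitG Gp; have ug' := unitG Gp'.
pose z := invmx p.1 *m p'.1; pose z' := invmx p'.1 *m p.1.
have z'z : z' *m z = 1%:M by rewrite /z' /z mulmxA mulmxK // mulVmx.
exists (fun q : V => (q.1 *m z, q.2)), (fun q : V => (q.1 *m z', q.2)); split.
- by move=> c a b; rewrite /= mulmxDl -scalemxAl.
- by move=> [a b] /=; rewrite -mulmxA z'z mulmx1.
- by rewrite /z mulKVmx // -p2; case: (p').
- move=> q /fiberE[Gq Sq Eq]; apply/fiberE; split=> //=.
    by apply: (GM) => //; apply: (GM) => //; apply: GV.
  (* Both g and g' conjugate x to - s, so z = g^-1 g' commutes with x. *)
  have xz : z *m x = x *m z.
    move: Ep Ep'; rewrite p2 => /eqP; rewrite addr_eq0 => /eqP Ep /eqP.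
    rewrite addrC addr_eq0 => /eqP Ep'.
    have xE : x = - (invmx p.1 *m p.2 *m p.1) by rewrite -mulmxA Ep mulmxN opprK mulKmx.
    by rewrite /z -mulmxA Ep' mulmxN xE mulNmx !mulmxA mulmxK.
  rewrite mulmxA -[q.1 *m z *m x]mulmxA xz [q.1 *m (x *m z)]mulmxA.
  by rewrite -mulmxDl Eq mul0mx.
Qed.

(** Only - <s, [y1, y2]> is left, and s commutes with y1. *)
Lemma omega_Phi_fiber p v1 v2 : X p -> tangent_space X p v1 ->
  tangent_space X p v2 -> omega G p v1 v2 = 0.
Proof.
move=> Xp Tv1 Tv2; have [z1 y1] := tangent_space_fiber Xp Tv1.
have [z2 _] := tangent_space_fiber Xp Tv2; rewrite /omega z1 z2 !killing_r0 !subr0 sub0r.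
have Ly v (Tv : tangent_space X p v) := tangent_lie Xp Tv.
have [_ [z /= Zz sE] _] := (fiberE p).1 Xp.
rewrite killing_commuting ?oppr0 ?Ly // -sE memvD //.
  by case: triple => -[[? [_ reg /reg[]]]].
by move: Zz; rewrite mem_centralizer => /andP[].
Qed.

End Fiber.

Theorem proposition10 (R : realType) (n : nat) (G : set 'M[C R]_n)
    (Galg : algebraic_group G) (Gconn : zariski_connected G)
    (Gsc : simply_connected G) (Gss : semisimple G)
    (xi h eta : 'M[C R]_n) (triple : regular_sl2_triple G xi h eta)
    (x : 'M[C R]_n) (xreg : regular_elements G x) :
  isotropic_subvariety G (slodowy_slice G xi eta)
    (Phi_fiber G (slodowy_slice G xi eta) x).
Proof.
have subG := Galg.1; split.
- exact: closed_Phi_fiber subG _ _ _.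
- exact: smooth_Phi_fiber subG _ _ _ triple _ xreg.
- exact: omega_Phi_fiber subG _ _ _ triple _ xreg.
Qed.
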